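(* Let $h:\Omega\to\mathbb{C}$ be a non-constant holomorphic map in a domain $\Omega\subset\mathbb{C}$ and let $E\subset\Omega$ be a compact set. Then $\dim_A h(E)\leq \dim_A E$.
   Context: Here $\dim_A$ denotes the Assouad dimension, defined as follows. For $z\in\mathbb{C}$ and $R>0$ let $D(z,R)$ be the open disc centered at $z$ of radius $R$. For $E\subset\mathbb{C}$ and $0<r\le R$, let $N(D(z,R)\cap E,r)$ be the smallest number of sets of diameter at most $r$ needed to cover $D(z,R)\cap E$. Then $\dim_A E$ is the infimum of all $\alpha>0$ for which there exists $C>0$ such that $N(D(z,R)\cap E,r)\le C(R/r)^\alpha$ for all $0<r\le R$ and all $z\in E$. *)

(* Defs.v *)
From Stdlib Require Import Reals List.
From Coquelicot Require Import Coquelicot.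

Open Scope R_scope.

Definition compact_set {T : UniformSpace} (K : T -> Prop) : Prop :=
  forall (I : Type) (U : I -> T -> Prop),
    (forall i, open (U i)) ->
    (forall x, K x -> exists i, U i x) ->
    exists l : list I, forall x, K x -> exists i, In i l /\ U i x.

Definition connected_set {T : UniformSpace} (A : T -> Prop) : Prop :=
  forall U V : T -> Prop,
    open U -> open V ->
    (forall x, A x -> U x \/ V x) ->
    (exists x, A x /\ U x) -> (exists x, A x /\ V x) ->
    exists x, A x /\ U x /\ V x.

Definition is_domain (Omega : C -> Prop) : Prop :=
  open Omega /\ connected_set Omega /\ exists z, Omega z.

(* The scalars are complex here, so [ex_derive] is complex differentiability. *)
Definition holomorphic_on (Omega : C -> Prop) (h : C -> C) : Prop :=
  forall z : C, Omega z -> @ex_derive C_AbsRing C_NormedModule h z.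

Definition constant_on (Omega : C -> Prop) (h : C -> C) : Prop :=
  exists c : C, forall z : C, Omega z -> h z = c.

Definition image_set (h : C -> C) (E : C -> Prop) : C -> Prop :=
  fun w => exists z, E z /\ h z = w.

(* [C_UniformSpace] has square balls; these are the round Euclidean ones. *)
Definition open_disc (z : C) (r : R) : C -> Prop :=
  fun w => Cmod (w - z)%C < r.

(* The value is [m_infty] on the empty set, so that the empty set has diameter
   at most [r] for every [r]. *)
Definition diam (A : C -> Prop) : Rbar :=
  Lub_Rbar (fun d => exists x y, A x /\ A y /\ d = Cmod (x - y)%C).

Definition covered_by (A : C -> Prop) (r : R) (n : nat) : Prop :=
  exists U : nat -> C -> Prop,
    (forall i, (i < n)%nat -> Rbar_le (diam (U i)) (Finite r)) /\
    (forall z, A z -> exists i, (i < n)%nat /\ U i z).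

(* An infimum of natural numbers, hence attained as soon as some finite cover
   exists; [p_infty] if there is none. *)
Definition covering_number (A : C -> Prop) (r : R) : Rbar :=
  Glb_Rbar (fun x => exists n : nat, covered_by A r n /\ x = INR n).

Definition assouad_exponent (E : C -> Prop) (alpha : R) : Prop :=
  0 < alpha /\
  exists c : R, 0 < c /\
    forall (z : C) (r rho : R), E z -> 0 < r <= rho ->
      Rbar_le (covering_number (fun w => open_disc z rho w /\ E w) r)
              (Finite (c * Rpower (rho / r) alpha)).

Definition assouad_dim (E : C -> Prop) : Rbar := Glb_Rbar (assouad_exponent E).

(* Main.v *)
Require Import Defs.
From Stdlib Require Import Reals List Lra Lia Classical Compare_dec.
From Coquelicot Require Import Coquelicot.

(** A bi-Lipschitz map preserves Assouad dimension, and a holomorphic map is locally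
    bi-Lipschitz except at its critical points. Near a critical point [a] it looks
    like a power: [h z = h a + (z - a) ^ m * g z] with [g] Lipschitz and [g a <> 0].
    A power contracts near [a], but scales and radii are contracted together, so the
    ratio that enters the definition of the dimension is preserved. Hence every
    exponent [alpha] valid for [E] is valid for [h(E)] ([assouad_exponent_image]).

    Consider a disc of radius [rad] around [h z0], to be covered at scale [s]. If
    [rad] is at least comparable to [|z0 - a| ^ m], the preimage lies in a disc of
    radius [t] around [a] with [t ^ m] comparable to [rad]; there [h] is Lipschitz with
    constant of order [t ^ (m - 1)], and one covering of [E] suffices
    ([transfer_near_center]). If [rad] is smaller, the preimage lies in an annulus
    around [a], which is cut into boundedly many pieces on which [h] is injective with
    both distortion bounds of order [t ^ (m - 1)] ([transfer_far_from_center]).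
    Compactness of [E] reduces the global statement to finitely many such points
    ([finite_transfer]).

    The factorization of [h] rests on Cauchy's theory. Goursat's theorem for rectangles
    ([goursat]) follows by repeated quartering, and gives Cauchy's formula on squares
    ([cauchy_formula]). Expanding the kernel by finitely many partial fractions expresses
    the Taylor remainders as contour integrals; either a first nonzero coefficient
    exists, which gives [m] and [g], or [h] is constant near [a] ([local_dichotomy]).
    Connectedness of the domain excludes the second case ([domain_has_order]). *)

(** * Continuity and differentiability of complex functions *)

Lemma Cmod_sub_sym (z w : C) : Cmod (z - w) = Cmod (w - z).
Proof. rewrite <- Cmod_opp; f_equal; ring. Qed.

Lemma Cmod_triangle_sub (a b c : C) : Cmod (a - c) <= Cmod (a - b) + Cmod (b - c).
Proof. replace (a - c)%C with ((a - b) + (b - c))%C by ring; apply Cmod_triangle. Qed.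

Lemma Cmod_ge_sub (a b : C) : Cmod a - Cmod b <= Cmod (a + b).
Proof.
  assert (H := Cmod_triangle (a + b) (- b)).
  replace (a + b + - b)%C with a in H by ring; rewrite Cmod_opp in H; lra.
Qed.

Lemma Cmod_ge_minus (a b : C) : Cmod a - Cmod b <= Cmod (a - b).
Proof. rewrite <- (Cmod_opp b); apply Cmod_ge_sub. Qed.

Lemma Cmod_sub_pos (z w : C) : z <> w -> 0 < Cmod (z - w).
Proof.
  intro H; apply Cmod_gt_0; intro E; apply H.
  replace z with ((z - w) + w)%C by ring; rewrite E; ring.
Qed.

Lemma Cmod_pos_neq (z w : C) : 0 < Cmod (z - w) -> (z - w)%C <> 0.
Proof. intros H; now apply Cmod_gt_0. Qed.

Lemma C_eq_dec (z w : C) : {z = w} + {z <> w}.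
Proof.
  destruct z as [a b], w as [c d].
  destruct (Req_dec_T a c) as [->|H]; [|right; congruence].
  destruct (Req_dec_T b d) as [->|H]; [now left|right; congruence].
Qed.

Definition ccont (f : C -> C) (z : C) : Prop :=
  forall eps, 0 < eps -> exists d, 0 < d /\
    forall w, Cmod (w - z) < d -> Cmod (f w - f z) < eps.

(** Caratheodory's form of complex differentiability: the difference quotient
    extends continuously, with value the derivative at [z]. *)
Definition cdiff (f : C -> C) (z : C) : Prop :=
  exists phi, ccont phi z /\ exists d, 0 < d /\
    forall w, Cmod (w - z) < d -> f w = (f z + phi w * (w - z))%C.

Lemma ex_derive_cdiff (f : C -> C) (z : C) :
  @ex_derive C_AbsRing C_NormedModule f z -> cdiff f z.
Proof.
  intros [l [_ Hl]].
  specialize (Hl z (fun P H => H)).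
  exists (fun w => if C_eq_dec w z then l else ((f w - f z) / (w - z))%C).
  split.
  - intros eps Heps.
    destruct (Hl (mkposreal (eps / 2) ltac:(lra))) as [d Hd]; simpl in Hd.
    exists d; split; [apply cond_pos|]; intros w Hw.
    destruct (C_eq_dec z z) as [_|]; [|congruence].
    destruct (C_eq_dec w z) as [->|Hne].
    + replace (l - l)%C with (RtoC 0) by ring; rewrite Cmod_0; lra.
    + assert (Hp := Cmod_sub_pos _ _ Hne).
      specialize (Hd w Hw).
      change (Cmod (f w - f z - (w - z) * l) <= eps / 2 * Cmod (w - z)) in Hd.
      replace ((f w - f z) / (w - z) - l)%C
        with ((f w - f z - (w - z) * l) / (w - z))%C
        by (field; now apply Cmod_pos_neq).
      rewrite Cmod_div by now apply Cmod_pos_neq.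
      apply Rle_lt_trans with (eps / 2); [|lra].
      apply (Rmult_le_reg_r (Cmod (w - z))); [exact Hp|].
      unfold Rdiv at 1; rewrite Rmult_assoc, Rinv_l, Rmult_1_r by lra; exact Hd.
  - exists 1; split; [lra|]; intros w _.
    destruct (C_eq_dec w z) as [->|Hne]; [ring|].
    field; apply Cmod_pos_neq, Cmod_sub_pos, Hne.
Qed.

Lemma ccont_const (c z : C) : ccont (fun _ => c) z.
Proof.
  intros eps H; exists 1; split; [lra|]; intros.
  replace (c - c)%C with (RtoC 0) by ring; rewrite Cmod_0; lra.
Qed.

Lemma ccont_id (z : C) : ccont (fun w => w) z.
Proof. intros eps H; exists eps; split; auto. Qed.

Lemma ccont_plus (f g : C -> C) (z : C) :
  ccont f z -> ccont g z -> ccont (fun w => f w + g w)%C z.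
Proof.
  intros Hf Hg eps He.
  destruct (Hf (eps / 2)) as [d1 [H1 K1]]; [lra|].
  destruct (Hg (eps / 2)) as [d2 [H2 K2]]; [lra|].
  exists (Rmin d1 d2); split; [now apply Rmin_pos|]; intros w Hw.
  replace (f w + g w - (f z + g z))%C with ((f w - f z) + (g w - g z))%C by ring.
  assert (A := Cmod_triangle (f w - f z) (g w - g z)).
  assert (Rmin d1 d2 <= d1) by apply Rmin_l.
  assert (Rmin d1 d2 <= d2) by apply Rmin_r.
  specialize (K1 w ltac:(lra)); specialize (K2 w ltac:(lra)); lra.
Qed.

Lemma ccont_mult (f g : C -> C) (z : C) :
  ccont f z -> ccont g z -> ccont (fun w => f w * g w)%C z.
Proof.
  intros Hf Hg eps He.
  set (M := 1 + Cmod (f z) + Cmod (g z)).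
  assert (HM : 0 < M) by (generalize (Cmod_ge_0 (f z)) (Cmod_ge_0 (g z)); unfold M; lra).
  set (e := Rmin 1 (eps / (2 * M))).
  assert (H0 : 0 < e) by (apply Rmin_pos; [lra|apply Rdiv_lt_0_compat; lra]).
  destruct (Hf e H0) as [d1 [H1 K1]].
  destruct (Hg e H0) as [d2 [H2 K2]].
  exists (Rmin d1 d2); split; [now apply Rmin_pos|]; intros w Hw.
  assert (Rmin d1 d2 <= d1) by apply Rmin_l.
  assert (Rmin d1 d2 <= d2) by apply Rmin_r.
  specialize (K1 w ltac:(lra)); specialize (K2 w ltac:(lra)).
  replace (f w * g w - f z * g z)%C
    with ((f w - f z) * (g w - g z) + ((f w - f z) * g z + f z * (g w - g z)))%C by ring.
  eapply Rle_lt_trans; [apply Cmod_triangle|].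
  eapply Rle_lt_trans; [apply Rplus_le_compat_l, Cmod_triangle|].
  rewrite !Cmod_mult.
  assert (He1 : e <= 1) by apply Rmin_l.
  assert (HeM : e * M <= eps / 2).
  { apply Rle_trans with (eps / (2 * M) * M).
    - apply Rmult_le_compat_r; [lra|apply Rmin_r].
    - right; field; lra. }
  generalize (Cmod_ge_0 (f z)) (Cmod_ge_0 (g z)) (Cmod_ge_0 (f w - f z))
    (Cmod_ge_0 (g w - g z)); intros.
  apply Rle_lt_trans with (e * M); [|lra]; unfold M.
  assert (Cmod (f w - f z) * Cmod (g w - g z) <= e * 1)
    by (apply Rmult_le_compat; lra).
  assert (Cmod (f w - f z) * Cmod (g z) <= e * Cmod (g z))
    by (apply Rmult_le_compat_r; lra).
  assert (Cmod (f z) * Cmod (g w - g z) <= Cmod (f z) * e)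
    by (apply Rmult_le_compat_l; lra).
  lra.
Qed.

Lemma ccont_inv_sub (c z : C) : z <> c -> ccont (fun w => / (w - c))%C z.
Proof.
  intros Hz eps He.
  assert (Hp := Cmod_sub_pos _ _ Hz); set (m := Cmod (z - c)) in *.
  set (d := Rmin (m / 2) (eps * m * m / 2)).
  assert (Hd : 0 < d).
  { apply Rmin_pos; [lra|]. repeat apply Rmult_lt_0_compat; lra. }
  assert (d <= m / 2) by apply Rmin_l.
  assert (d <= eps * m * m / 2) by apply Rmin_r.
  exists d; split; [exact Hd|]; intros w Hw.
  assert (Hwm : m / 2 < Cmod (w - c)).
  { assert (A := Cmod_triangle_sub z w c).
    rewrite (Cmod_sub_sym z w) in A; fold m in A; lra. }
  assert (Hw0 : (w - c)%C <> 0) by (apply Cmod_pos_neq; lra).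
  assert (Hz0 : (z - c)%C <> 0) by (apply Cmod_pos_neq; exact Hp).
  replace (/ (w - c) - / (z - c))%C with ((z - w) / ((w - c) * (z - c)))%C
    by (field; auto).
  rewrite Cmod_div by (apply Cmult_neq_0; auto).
  rewrite Cmod_mult; fold m; rewrite (Cmod_sub_sym z w).
  apply (Rmult_lt_reg_r (Cmod (w - c) * m)); [apply Rmult_lt_0_compat; lra|].
  unfold Rdiv; rewrite Rmult_assoc, Rinv_l, Rmult_1_r
    by (apply Rgt_not_eq, Rmult_lt_0_compat; lra).
  apply Rlt_le_trans with (eps * m * m / 2); [lra|].
  assert (eps * m * (m / 2) <= eps * m * Cmod (w - c)); [|lra].
  apply Rmult_le_compat_l; [|lra]; apply Rmult_le_pos; lra.
Qed.

Lemma ccont_pow (f : C -> C) (z : C) (n : nat) :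
  ccont f z -> ccont (fun w => f w ^ n)%C z.
Proof.
  intro H; induction n as [|n IH]; simpl.
  - apply ccont_const.
  - now apply ccont_mult.
Qed.

Lemma cdiff_ccont (f : C -> C) (z : C) : cdiff f z -> ccont f z.
Proof.
  intros [phi [Hphi [d [Hd E]]]] eps He.
  assert (H : ccont (fun w => f z + phi w * (w - z))%C z).
  { apply ccont_plus; [apply ccont_const|].
    apply ccont_mult; [exact Hphi|].
    apply (ccont_plus (fun w => w)); [apply ccont_id|apply ccont_const]. }
  destruct (H eps He) as [d' [Hd' K]].
  exists (Rmin d d'); split; [now apply Rmin_pos|]; intros w Hw.
  assert (Rmin d d' <= d) by apply Rmin_l.
  assert (Rmin d d' <= d') by apply Rmin_r.
  specialize (K w ltac:(lra)); rewrite E by lra.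
  replace (f z + phi w * (w - z) - f z)%C
    with (f z + phi w * (w - z) - (f z + phi z * (z - z)))%C by ring; exact K.
Qed.

Lemma cdiff_const (c z : C) : cdiff (fun _ => c) z.
Proof.
  exists (fun _ => RtoC 0); split; [apply ccont_const|].
  exists 1; split; [lra|]; intros; ring.
Qed.

(** Covers the difference quotient of [f], with [c = f p], and, for constant [f],
    the Cauchy kernel. *)
Lemma cdiff_quotient (f : C -> C) (c p z : C) :
  z <> p -> cdiff f z -> cdiff (fun w => (f w - c) / (w - p))%C z.
Proof.
  intros Hz [phi [Hphi [d [Hd E]]]].
  assert (Hp := Cmod_sub_pos _ _ Hz).
  exists (fun w => (phi w + (c - f z) * / (z - p)) * / (w - p))%C; split.
  - apply ccont_mult; [apply ccont_plus; [exact Hphi|apply ccont_const]|].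
    now apply ccont_inv_sub.
  - exists (Rmin d (Cmod (z - p))); split; [now apply Rmin_pos|]; intros w Hw.
    assert (Rmin d (Cmod (z - p)) <= d) by apply Rmin_l.
    assert (Rmin d (Cmod (z - p)) <= Cmod (z - p)) by apply Rmin_r.
    assert (Hwp : (w - p)%C <> 0).
    { apply Cmod_gt_0. assert (A := Cmod_triangle_sub z w p).
      rewrite (Cmod_sub_sym z w) in A; lra. }
    assert (Hzp : (z - p)%C <> 0) by (apply Cmod_pos_neq; exact Hp).
    rewrite E by lra; field; auto.
Qed.

(** * Integrals along the edges of a rectangle *)

(** [C] carries several normed structures; a function of a real variable is
    integrated in the one over the reals. *)
Definition Cint (f : R -> C) (a b : R) : C := @RInt C_R_CompleteNormedModule f a b.

Definition ex_Cint (f : R -> C) (a b : R) : Prop :=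
  @ex_RInt C_R_NormedModule f a b.

Lemma ex_Cint_ccont_h (f : C -> C) (y a b : R) :
  a <= b -> (forall x, a <= x <= b -> ccont f (x, y)) ->
  ex_Cint (fun x => f (x, y)) a b.
Proof.
  intros Hab H; apply (@ex_RInt_continuous C_R_CompleteNormedModule).
  rewrite Rmin_left, Rmax_right by lra; intros x Hx.
  apply filterlim_locally; intros eps.
  destruct (H x Hx eps (cond_pos eps)) as [d [Hd K]].
  exists (mkposreal d Hd); intros t Ht.
  apply (C_NormedModule_mixin_compat1 (f (x, y)) (f (t, y)) eps).
  apply K.
  replace ((t, y) - (x, y))%C with (RtoC (t - x))
    by (unfold RtoC, Cminus, Cplus, Copp; simpl; f_equal; ring).
  rewrite Cmod_R; exact Ht.
Qed.

Lemma ex_Cint_ccont_v (f : C -> C) (x a b : R) :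
  a <= b -> (forall y, a <= y <= b -> ccont f (x, y)) ->
  ex_Cint (fun y => f (x, y)) a b.
Proof.
  intros Hab H; apply (@ex_RInt_continuous C_R_CompleteNormedModule).
  rewrite Rmin_left, Rmax_right by lra; intros y Hy.
  apply filterlim_locally; intros eps.
  destruct (H y Hy eps (cond_pos eps)) as [d [Hd K]].
  exists (mkposreal d Hd); intros t Ht.
  apply (C_NormedModule_mixin_compat1 (f (x, y)) (f (x, t)) eps).
  apply K.
  replace ((x, t) - (x, y))%C with (Ci * RtoC (t - y))%C
    by (unfold RtoC, Cminus, Cplus, Copp, Ci, Cmult; simpl; f_equal; ring).
  rewrite Cmod_mult, Cmod_Ci, Cmod_R, Rmult_1_l; exact Ht.
Qed.

Lemma Cint_plus (f g : R -> C) (a b : R) :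
  ex_Cint f a b -> ex_Cint g a b ->
  ex_Cint (fun t => f t + g t)%C a b /\
  Cint (fun t => f t + g t)%C a b = (Cint f a b + Cint g a b)%C.
Proof.
  intros Hf Hg; split.
  - exact (@ex_RInt_plus C_R_NormedModule f g a b Hf Hg).
  - exact (@RInt_plus C_R_CompleteNormedModule f g a b Hf Hg).
Qed.

(** The structure used for integration has real scalars only, so a complex factor
    is handled through real and imaginary parts. *)
Lemma is_Cint_scal (c : C) (f : R -> C) (a b : R) (l : C) :
  @is_RInt C_R_NormedModule f a b l ->
  @is_RInt C_R_NormedModule (fun t => c * f t)%C a b (c * l)%C.
Proof.
  intros H.
  assert (H1 := @is_RInt_fct_extend_fst R_NormedModule R_NormedModule f a b l H).
  assert (H2 := @is_RInt_fct_extend_snd R_NormedModule R_NormedModule f a b l H).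
  apply (@is_RInt_fct_extend_pair R_NormedModule R_NormedModule
           (fun t => c * f t)%C a b).
  - exact (is_RInt_minus _ _ _ _ _ _ (is_RInt_scal _ _ _ (fst c) _ H1)
                         (is_RInt_scal _ _ _ (snd c) _ H2)).
  - exact (is_RInt_plus _ _ _ _ _ _ (is_RInt_scal _ _ _ (fst c) _ H2)
                         (is_RInt_scal _ _ _ (snd c) _ H1)).
Qed.

Lemma Cint_scal (c : C) (f : R -> C) (a b : R) :
  ex_Cint f a b ->
  ex_Cint (fun t => c * f t)%C a b /\
  Cint (fun t => c * f t)%C a b = (c * Cint f a b)%C.
Proof.
  intros H.
  assert (K := is_Cint_scal c f a b _ (@RInt_correct C_R_CompleteNormedModule f a b H)).
  split; [now exists (c * Cint f a b)%C|].
  exact (@is_RInt_unique C_R_CompleteNormedModule _ a b _ K).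
Qed.

Lemma Cint_const (c : C) (a b : R) :
  ex_Cint (fun _ => c) a b /\ Cint (fun _ => c) a b = (RtoC (b - a) * c)%C.
Proof.
  split; [apply ex_RInt_const|].
  unfold Cint; rewrite RInt_const.
  change (@scal R_Ring C_R_ModuleSpace (b - a) c = (RtoC (b - a) * c)%C).
  destruct c as [u v]; unfold scal, RtoC, Cmult; simpl.
  unfold prod_scal, scal; simpl; unfold mult; simpl; f_equal; ring.
Qed.

Lemma Cint_Chasles (f : R -> C) (a b c : R) :
  ex_Cint f a b -> ex_Cint f b c -> (Cint f a b + Cint f b c)%C = Cint f a c.
Proof. intros; now apply (@RInt_Chasles C_R_CompleteNormedModule). Qed.

Lemma Cint_ext (f g : R -> C) (a b : R) :
  a <= b -> (forall t, a <= t <= b -> f t = g t) -> Cint f a b = Cint g a b.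
Proof.
  intros Hab H; apply (@RInt_ext C_R_CompleteNormedModule).
  rewrite Rmin_left, Rmax_right by lra; intros; apply H; lra.
Qed.

Lemma Cint_bound (f : R -> C) (a b M : R) :
  a <= b -> ex_Cint f a b -> (forall t, a <= t <= b -> Cmod (f t) <= M) ->
  Cmod (Cint f a b) <= (b - a) * M.
Proof.
  intros Hab Hf H; rewrite Cmod_norm.
  apply (@norm_RInt_le_const C_R_NormedModule f a b _ M Hab).
  - intros t Ht; assert (A := H t Ht); rewrite Cmod_norm in A; exact A.
  - exact (@RInt_correct C_R_CompleteNormedModule f a b Hf).
Qed.

(** The contour integral along the boundary of a rectangle, counterclockwise;
    [Ci] comes from the parametrization of the vertical edges. *)
Definition oint (f : C -> C) (x0 x1 y0 y1 : R) : C :=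
  (Cint (fun x => f (x, y0)) x0 x1 - Cint (fun x => f (x, y1)) x0 x1
   + Ci * (Cint (fun y => f (x1, y)) y0 y1 - Cint (fun y => f (x0, y)) y0 y1))%C.

Definition in_rect (x0 x1 y0 y1 : R) (z : C) : Prop :=
  x0 <= fst z <= x1 /\ y0 <= snd z <= y1.

Definition on_edges (x0 x1 y0 y1 : R) (z : C) : Prop :=
  in_rect x0 x1 y0 y1 z /\
  (fst z = x0 \/ fst z = x1 \/ snd z = y0 \/ snd z = y1).

Definition oint_ok (f : C -> C) (x0 x1 y0 y1 : R) : Prop :=
  x0 <= x1 /\ y0 <= y1 /\
  ex_Cint (fun x => f (x, y0)) x0 x1 /\ ex_Cint (fun x => f (x, y1)) x0 x1 /\
  ex_Cint (fun y => f (x0, y)) y0 y1 /\ ex_Cint (fun y => f (x1, y)) y0 y1.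

Lemma oint_ok_ccont (f : C -> C) (x0 x1 y0 y1 : R) :
  x0 <= x1 -> y0 <= y1 ->
  (forall z, on_edges x0 x1 y0 y1 z -> ccont f z) -> oint_ok f x0 x1 y0 y1.
Proof.
  intros Hx Hy H; refine (conj Hx (conj Hy (conj _ (conj _ (conj _ _)))));
  [apply (ex_Cint_ccont_h f) | apply (ex_Cint_ccont_h f)
  | apply (ex_Cint_ccont_v f) | apply (ex_Cint_ccont_v f)]; try assumption;
  intros; apply H; unfold on_edges, in_rect; simpl; (split; [lra|tauto]).
Qed.

Lemma oint_plus (f g : C -> C) (x0 x1 y0 y1 : R) :
  oint_ok f x0 x1 y0 y1 -> oint_ok g x0 x1 y0 y1 ->
  oint (fun z => f z + g z)%C x0 x1 y0 y1
  = (oint f x0 x1 y0 y1 + oint g x0 x1 y0 y1)%C.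
Proof.
  intros (Hx & Hy & A1 & A2 & A3 & A4) (_ & _ & B1 & B2 & B3 & B4).
  unfold oint.
  rewrite (proj2 (Cint_plus _ _ _ _ A1 B1)), (proj2 (Cint_plus _ _ _ _ A2 B2)),
    (proj2 (Cint_plus _ _ _ _ A3 B3)), (proj2 (Cint_plus _ _ _ _ A4 B4)).
  ring.
Qed.

Lemma oint_scal (c : C) (f : C -> C) (x0 x1 y0 y1 : R) :
  oint_ok f x0 x1 y0 y1 ->
  oint (fun z => c * f z)%C x0 x1 y0 y1 = (c * oint f x0 x1 y0 y1)%C.
Proof.
  intros (Hx & Hy & A1 & A2 & A3 & A4); unfold oint.
  rewrite (proj2 (Cint_scal c _ _ _ A1)), (proj2 (Cint_scal c _ _ _ A2)),
    (proj2 (Cint_scal c _ _ _ A3)), (proj2 (Cint_scal c _ _ _ A4)).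
  ring.
Qed.

Lemma oint_ext (f g : C -> C) (x0 x1 y0 y1 : R) :
  x0 <= x1 -> y0 <= y1 ->
  (forall z, on_edges x0 x1 y0 y1 z -> f z = g z) ->
  oint f x0 x1 y0 y1 = oint g x0 x1 y0 y1.
Proof.
  intros Hx Hy H; unfold oint.
  rewrite (Cint_ext (fun x => f (x, y0)) (fun x => g (x, y0))),
    (Cint_ext (fun x => f (x, y1)) (fun x => g (x, y1))),
    (Cint_ext (fun y => f (x1, y)) (fun y => g (x1, y))),
    (Cint_ext (fun y => f (x0, y)) (fun y => g (x0, y))); auto;
  intros; apply H; unfold on_edges, in_rect; simpl; (split; [lra|tauto]).
Qed.

Lemma oint_bound (f : C -> C) (x0 x1 y0 y1 M : R) :
  oint_ok f x0 x1 y0 y1 ->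
  (forall z, on_edges x0 x1 y0 y1 z -> Cmod (f z) <= M) ->
  Cmod (oint f x0 x1 y0 y1) <= 2 * ((x1 - x0) + (y1 - y0)) * M.
Proof.
  intros (Hx & Hy & A1 & A2 & A3 & A4) H; unfold oint.
  apply Cint_bound with (M := M) in A1; apply Cint_bound with (M := M) in A2;
  apply Cint_bound with (M := M) in A3; apply Cint_bound with (M := M) in A4;
  try (lra || (intros; apply H; unfold on_edges, in_rect; simpl; (split; [lra|tauto]))).
  eapply Rle_trans; [apply Cmod_triangle|].
  rewrite Cmod_mult, Cmod_Ci.
  eapply Rle_trans.
  - apply Rplus_le_compat; [apply Cmod_triangle|].
    apply Rmult_le_compat_l; [lra|apply Cmod_triangle].
  - rewrite !Cmod_opp; lra.
Qed.

Lemma oint_split_x (f : C -> C) (x0 x1 x2 y0 y1 : R) :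
  oint_ok f x0 x1 y0 y1 -> oint_ok f x1 x2 y0 y1 ->
  oint f x0 x2 y0 y1 = (oint f x0 x1 y0 y1 + oint f x1 x2 y0 y1)%C.
Proof.
  intros (Hx & Hy & A1 & A2 & A3 & A4) (_ & _ & B1 & B2 & B3 & B4); unfold oint.
  rewrite <- (Cint_Chasles _ _ _ _ A1 B1), <- (Cint_Chasles _ _ _ _ A2 B2); ring.
Qed.

Lemma oint_split_y (f : C -> C) (x0 x1 y0 y1 y2 : R) :
  oint_ok f x0 x1 y0 y1 -> oint_ok f x0 x1 y1 y2 ->
  oint f x0 x1 y0 y2 = (oint f x0 x1 y0 y1 + oint f x0 x1 y1 y2)%C.
Proof.
  intros (Hx & Hy & A1 & A2 & A3 & A4) (_ & _ & B1 & B2 & B3 & B4); unfold oint.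
  rewrite <- (Cint_Chasles _ _ _ _ A3 B3), <- (Cint_Chasles _ _ _ _ A4 B4); ring.
Qed.

Lemma affine_ccont (A B p z : C) : ccont (fun w => A + B * (w - p))%C z.
Proof.
  apply ccont_plus; [apply ccont_const|].
  apply ccont_mult; [apply ccont_const|].
  apply (ccont_plus (fun w => w)); [apply ccont_id|apply ccont_const].
Qed.

(** Opposite edges differ by a constant, so no antiderivative is involved. *)
Lemma oint_affine (A B p : C) (x0 x1 y0 y1 : R) :
  x0 <= x1 -> y0 <= y1 ->
  oint (fun w => A + B * (w - p))%C x0 x1 y0 y1 = 0.
Proof.
  intros Hx Hy; unfold oint.
  assert (K := oint_ok_ccont (fun w => A + B * (w - p))%C x0 x1 y0 y1 Hx Hy
                 (fun z _ => affine_ccont A B p z)).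
  destruct K as (_ & _ & A1 & A2 & A3 & A4).
  destruct (Cint_const (B * (Ci * RtoC (y0 - y1))) x0 x1) as [E1 E1'].
  destruct (Cint_const (B * RtoC (x1 - x0)) y0 y1) as [E2 E2'].
  assert (F1 : Cint (fun x => (A + B * ((x, y0) - p))%C) x0 x1
     = (Cint (fun x => (A + B * ((x, y1) - p))%C) x0 x1
        + RtoC (x1 - x0) * (B * (Ci * RtoC (y0 - y1))))%C).
  { rewrite <- E1', <- (proj2 (Cint_plus _ _ _ _ A2 E1)).
    apply Cint_ext; [lra|]; intros t _.
    replace (t, y0) with ((t, y1) + Ci * RtoC (y0 - y1))%C; [ring|].
    unfold RtoC, Cplus, Cmult, Ci; simpl; f_equal; ring. }
  assert (F2 : Cint (fun y => (A + B * ((x1, y) - p))%C) y0 y1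
     = (Cint (fun y => (A + B * ((x0, y) - p))%C) y0 y1
        + RtoC (y1 - y0) * (B * RtoC (x1 - x0)))%C).
  { rewrite <- E2', <- (proj2 (Cint_plus _ _ _ _ A3 E2)).
    apply Cint_ext; [lra|]; intros t _.
    replace (x1, t) with ((x0, t) + RtoC (x1 - x0))%C; [ring|].
    unfold RtoC, Cplus; simpl; f_equal; ring. }
  rewrite F1, F2, !RtoC_minus; ring.
Qed.

Lemma in_rect_diam (x0 x1 y0 y1 : R) (z w : C) :
  in_rect x0 x1 y0 y1 z -> in_rect x0 x1 y0 y1 w ->
  Cmod (z - w) <= (x1 - x0) + (y1 - y0).
Proof.
  intros [Hz1 Hz2] [Hw1 Hw2].
  replace (z - w)%C with (RtoC (fst z - fst w) + Ci * RtoC (snd z - snd w))%C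
    by (destruct z, w; unfold RtoC, Cminus, Copp, Cplus, Cmult, Ci; simpl; f_equal; ring).
  eapply Rle_trans; [apply Cmod_triangle|].
  rewrite Cmod_mult, Cmod_Ci, !Cmod_R, Rmult_1_l.
  apply Rplus_le_compat; apply Rabs_le; lra.
Qed.

(** On a small rectangle around [p] a function differentiable at [p] is affine
    up to an error that is small compared with the size of the rectangle. *)
Lemma oint_local (f : C -> C) (p : C) : cdiff f p ->
  forall eps, 0 < eps -> exists d, 0 < d /\
    forall x0 x1 y0 y1, in_rect x0 x1 y0 y1 p ->
      (x1 - x0) + (y1 - y0) < d -> oint_ok f x0 x1 y0 y1 ->
      Cmod (oint f x0 x1 y0 y1) <= eps * ((x1 - x0) + (y1 - y0)) ^ 2.
Proof.
  intros [phi [Hphi [d1 [Hd1 E]]]] eps He.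
  destruct (Hphi (eps / 2) ltac:(lra)) as [d2 [Hd2 K]].
  exists (Rmin d1 d2); split; [now apply Rmin_pos|].
  intros x0 x1 y0 y1 Hp Hs Hok.
  assert (Rmin d1 d2 <= d1) by apply Rmin_l.
  assert (Rmin d1 d2 <= d2) by apply Rmin_r.
  assert (Hx : x0 <= x1) by apply Hok.
  assert (Hy : y0 <= y1) by apply Hok.
  set (s := (x1 - x0) + (y1 - y0)) in *.
  set (aff := fun w => (- f p + - phi p * (w - p))%C).
  assert (Haff : oint_ok aff x0 x1 y0 y1)
    by (apply oint_ok_ccont; auto; intros; apply affine_ccont).
  assert (Hsum : oint_ok (fun w => f w + aff w)%C x0 x1 y0 y1).
  { destruct Hok as (_ & _ & A1 & A2 & A3 & A4).
    destruct Haff as (_ & _ & B1 & B2 & B3 & B4).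
    refine (conj Hx (conj Hy (conj _ (conj _ (conj _ _))))).
    - apply (Cint_plus _ _ _ _ A1 B1).
    - apply (Cint_plus _ _ _ _ A2 B2).
    - apply (Cint_plus _ _ _ _ A3 B3).
    - apply (Cint_plus _ _ _ _ A4 B4). }
  replace (oint f x0 x1 y0 y1) with (oint (fun w => f w + aff w)%C x0 x1 y0 y1)
    by (rewrite oint_plus by assumption;
        unfold aff; rewrite oint_affine by assumption; ring).
  apply Rle_trans with (2 * s * (eps / 2 * s)); [|simpl; right; field].
  apply oint_bound; [exact Hsum|]; intros z [Hz _].
  assert (Hzp := in_rect_diam _ _ _ _ _ _ Hz Hp); fold s in Hzp.
  unfold aff; rewrite E by lra.
  replace (f p + phi z * (z - p) + (- f p + - phi p * (z - p)))%C
    with ((phi z - phi p) * (z - p))%C by ring.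
  rewrite Cmod_mult; apply Rmult_le_compat; try apply Cmod_ge_0; [|exact Hzp].
  left; apply K; lra.
Qed.

(** * Goursat's theorem *)

Lemma nested_intervals (u v : nat -> R) :
  (forall n, u n <= u (S n)) -> (forall n, v (S n) <= v n) ->
  (forall n, u n <= v n) -> exists l, forall n, u n <= l <= v n.
Proof.
  intros Hu Hv Huv.
  assert (Mu : forall n k, u n <= u (k + n)%nat).
  { intros n k; induction k as [|k IH]; simpl; [lra|]. specialize (Hu (k + n)%nat); lra. }
  assert (Mv : forall n k, v (k + n)%nat <= v n).
  { intros n k; induction k as [|k IH]; simpl; [lra|]. specialize (Hv (k + n)%nat); lra. }
  assert (B : forall n k, u k <= v n).
  { intros n k. specialize (Mu k n); specialize (Mv n k); specialize (Huv (n + k)%nat).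
    rewrite (Nat.add_comm k n) in Mv; lra. }
  destruct (completeness (fun x => exists n, x = u n)) as [l [Hl1 Hl2]].
  - exists (v O); intros x [n ->]; apply B.
  - exists (u O); now exists O.
  - exists l; intro n; split; [apply Hl1; now exists n|].
    apply Hl2; intros x [k ->]; apply B.
Qed.

Lemma half_pos (s : R) (n : nat) : 0 <= s -> 0 <= s / 2 ^ n /\ s / 2 ^ n = 2 * (s / 2 ^ S n).
Proof.
  intro H. assert (0 < 2 ^ n) by (apply pow_lt; lra).
  split; [|simpl; field; lra].
  apply Rmult_le_pos; [exact H|]. left; now apply Rinv_0_lt_compat.
Qed.

Section Bisection.

Variables (Phi : R -> R -> R -> R -> R) (x0 x1 y0 y1 : R).
Hypotheses (Hx : x0 <= x1) (Hy : y0 <= y1).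
Hypothesis Hsub : forall a b c d, x0 <= a <= b -> b <= x1 -> y0 <= c <= d -> d <= y1 ->
  Phi a b c d <= Phi a ((a + b) / 2) c ((c + d) / 2) + Phi ((a + b) / 2) b c ((c + d) / 2)
    + (Phi a ((a + b) / 2) ((c + d) / 2) d + Phi ((a + b) / 2) b ((c + d) / 2) d).

Let w (n : nat) := (x1 - x0) / 2 ^ n.
Let h (n : nat) := (y1 - y0) / 2 ^ n.
Let Q (n : nat) (p : R * R) := Phi (fst p) (fst p + w n) (snd p) (snd p + h n).

(** Chooses a quarter on which [Phi] keeps at least a fourth of its value; when
    three quarters fail, subadditivity makes the last one succeed. *)
Let step (n : nat) (p : R * R) : R * R :=
  let a := w (S n) in let b := h (S n) in
  let (x, y) := p in
  if Rle_dec (Q n p / 4) (Q (S n) (x, y)) then (x, y)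
  else if Rle_dec (Q n p / 4) (Q (S n) (x + a, y)) then (x + a, y)
  else if Rle_dec (Q n p / 4) (Q (S n) (x, y + b)) then (x, y + b)
  else (x + a, y + b).

Let corner := fix corner (n : nat) : R * R :=
  match n with O => (x0, y0) | S k => step k (corner k) end.

Let in_n (n : nat) (p : R * R) :=
  x0 <= fst p /\ fst p + w n <= x1 /\ y0 <= snd p /\ snd p + h n <= y1.

Lemma step_spec (n : nat) (p : R * R) : in_n n p ->
  in_n (S n) (step n p) /\ Q n p / 4 <= Q (S n) (step n p) /\
  fst p <= fst (step n p) /\ fst (step n p) + w (S n) <= fst p + w n /\
  snd p <= snd (step n p) /\ snd (step n p) + h (S n) <= snd p + h n.
Proof.
  destruct p as [x y]; unfold in_n; simpl fst; simpl snd; intros (A & B & D & E).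
  destruct (half_pos (x1 - x0) n) as [W1 W2]; [lra|].
  destruct (half_pos (x1 - x0) (S n)) as [W3 _]; [lra|].
  destruct (half_pos (y1 - y0) n) as [V1 V2]; [lra|].
  destruct (half_pos (y1 - y0) (S n)) as [V3 _]; [lra|].
  fold (w n) in W1, W2; fold (w (S n)) in W2, W3.
  fold (h n) in V1, V2; fold (h (S n)) in V2, V3.
  assert (F : Q n (x, y) <= Q (S n) (x, y) + Q (S n) (x + w (S n), y)
     + (Q (S n) (x, y + h (S n)) + Q (S n) (x + w (S n), y + h (S n)))).
  { unfold Q; simpl fst; simpl snd.
    assert (G := Hsub x (x + w n) y (y + h n)).
    replace ((x + (x + w n)) / 2) with (x + w (S n)) in G by lra.
    replace ((y + (y + h n)) / 2) with (y + h (S n)) in G by lra.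
    replace (x + w (S n) + w (S n)) with (x + w n) by lra.
    replace (y + h (S n) + h (S n)) with (y + h n) by lra.
    apply G; lra. }
  unfold step.
  destruct (Rle_dec _ _); [|destruct (Rle_dec _ _); [|destruct (Rle_dec _ _)]];
  simpl fst; simpl snd; repeat split; lra.
Qed.

Lemma corner_spec (n : nat) :
  in_n n (corner n) /\ Phi x0 x1 y0 y1 / 4 ^ n <= Q n (corner n).
Proof.
  induction n as [|n [IH1 IH2]].
  - unfold in_n, Q, w, h; simpl.
    replace (x0 + (x1 - x0) / 1) with x1 by field.
    replace (y0 + (y1 - y0) / 1) with y1 by field.
    repeat split; try lra.
  - destruct (step_spec n _ IH1) as (A & B & _).
    split; [exact A|].
    change (corner (S n)) with (step n (corner n)).
    assert (0 < 4 ^ n) by (apply pow_lt; lra).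
    replace (Phi x0 x1 y0 y1 / 4 ^ S n) with (Phi x0 x1 y0 y1 / 4 ^ n / 4)
      by (simpl; field; lra).
    lra.
Qed.

(** A subadditive function of rectangles that is of smaller order than the
    squared size near each point is not positive: otherwise repeated quartering
    leads to a point around which it is of the order of the squared size. *)
Lemma rect_bisection :
  (forall p, in_rect x0 x1 y0 y1 p -> forall eps, 0 < eps -> exists d, 0 < d /\
    forall a b c e, x0 <= a <= b -> b <= x1 -> y0 <= c <= e -> e <= y1 ->
      in_rect a b c e p -> (b - a) + (e - c) < d ->
      Phi a b c e <= eps * ((b - a) + (e - c)) ^ 2) ->
  Phi x0 x1 y0 y1 <= 0.
Proof.
  intros Hloc; apply Rnot_lt_le; intros Hpos.
  assert (HW : forall n, 0 <= w n /\ w n = 2 * w (S n))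
    by (intro n; apply half_pos; lra).
  assert (HH : forall n, 0 <= h n /\ h n = 2 * h (S n))
    by (intro n; apply half_pos; lra).
  assert (HS : forall n, _) by exact (fun n => step_spec n _ (proj1 (corner_spec n))).
  destruct (nested_intervals (fun n => fst (corner n)) (fun n => fst (corner n) + w n))
    as [px Hpx].
  { intro n; apply (HS n). } { intro n; apply (HS n). } { intro n; generalize (HW n); lra. }
  destruct (nested_intervals (fun n => snd (corner n)) (fun n => snd (corner n) + h n))
    as [py Hpy].
  { intro n; apply (HS n). } { intro n; apply (HS n). } { intro n; generalize (HH n); lra. }
  set (s := (x1 - x0) + (y1 - y0)).
  set (eps := Phi x0 x1 y0 y1 / (2 * (s ^ 2 + 1))).
  assert (Hs2 : 0 <= s ^ 2) by apply pow2_ge_0.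
  assert (Heps : 0 < eps) by (apply Rdiv_lt_0_compat; lra).
  destruct (Hloc (px, py)) with (eps := eps) as [d [Hd K]]; [|exact Heps|].
  { specialize (Hpx O); specialize (Hpy O).
    unfold w, h in Hpx, Hpy; simpl in Hpx, Hpy; unfold in_rect; simpl.
    replace (x0 + (x1 - x0) / 1) with x1 in Hpx by field.
    replace (y0 + (y1 - y0) / 1) with y1 in Hpy by field. lra. }
  destruct (pow_lt_1_zero (/ 2)) with (y := d / (s + 1)) as [N HN].
  { rewrite Rabs_pos_eq; lra. }
  { apply Rdiv_lt_0_compat; unfold s; lra. }
  specialize (HN N ltac:(lia)).
  assert (H2N : 0 < 2 ^ N) by (apply pow_lt; lra).
  rewrite pow_inv, Rabs_pos_eq in HN by (left; now apply Rinv_0_lt_compat).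
  assert (Hs : 0 <= s) by (unfold s; lra).
  assert (HsN : w N + h N = s * / 2 ^ N) by (unfold w, h, s; field; lra).
  assert (Hsmall : s * / 2 ^ N < d).
  { apply Rle_lt_trans with ((s + 1) * / 2 ^ N).
    - apply Rmult_le_compat_r; [left; now apply Rinv_0_lt_compat|lra].
    - apply Rlt_le_trans with ((s + 1) * (d / (s + 1))); [|right; field; lra].
      apply Rmult_lt_compat_l; lra. }
  destruct (corner_spec N) as [(A & B & D & E) F].
  specialize (K (fst (corner N)) (fst (corner N) + w N) (snd (corner N)) (snd (corner N) + h N)).
  replace (fst (corner N) + w N - fst (corner N)
           + (snd (corner N) + h N - snd (corner N))) with (s * / 2 ^ N) in K by lra.
  generalize (HW N) (HH N); intros.
  specialize (K ltac:(lra) ltac:(lra) ltac:(lra) ltac:(lra) (conj (Hpx N) (Hpy N)) Hsmall).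
  unfold Q in F.
  assert (H4 : 4 ^ N = 2 ^ N * 2 ^ N) by (rewrite <- Rpow_mult_distr; f_equal; lra).
  assert (G : Phi x0 x1 y0 y1 / 4 ^ N <= eps * (s * / 2 ^ N) ^ 2) by lra.
  rewrite H4 in G.
  apply (Rmult_le_compat_r (2 ^ N * 2 ^ N)) in G; [|apply Rmult_le_pos; lra].
  replace (Phi x0 x1 y0 y1 / (2 ^ N * 2 ^ N) * (2 ^ N * 2 ^ N))
    with (Phi x0 x1 y0 y1) in G by (field; lra).
  replace (eps * (s * / 2 ^ N) ^ 2 * (2 ^ N * 2 ^ N))
    with (Phi x0 x1 y0 y1 * (s ^ 2 / (2 * (s ^ 2 + 1)))) in G
    by (unfold eps; field; lra).
  assert (s ^ 2 / (2 * (s ^ 2 + 1)) < 1).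
  { apply (Rmult_lt_reg_r (2 * (s ^ 2 + 1))); [lra|].
    unfold Rdiv; rewrite Rmult_assoc, Rinv_l by lra; lra. }
  assert (Phi x0 x1 y0 y1 * (s ^ 2 / (2 * (s ^ 2 + 1))) < Phi x0 x1 y0 y1 * 1)
    by (apply Rmult_lt_compat_l; lra).
  lra.
Qed.

End Bisection.

(** Contour integrals are additive under quartering and, by [oint_local], of
    smaller order than the squared size near each point. *)
Lemma goursat (f : C -> C) (x0 x1 y0 y1 : R) :
  x0 <= x1 -> y0 <= y1 -> (forall z, in_rect x0 x1 y0 y1 z -> cdiff f z) ->
  oint f x0 x1 y0 y1 = 0.
Proof.
  intros Hx Hy Hf.
  assert (Hok : forall a b c d, x0 <= a <= b -> b <= x1 -> y0 <= c <= d -> d <= y1 ->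
    oint_ok f a b c d).
  { intros a b c d A B D E; apply oint_ok_ccont; try lra.
    intros z [[Z1 Z2] _]; apply cdiff_ccont, Hf; split; lra. }
  apply Cmod_eq_0, Rle_antisym; [|apply Cmod_ge_0].
  apply (rect_bisection (fun a b c d => Cmod (oint f a b c d))); try assumption.
  - intros a b c d A B D E.
    set (m := (a + b) / 2); set (n := (c + d) / 2).
    assert (Hm : a <= m <= b) by (unfold m; lra).
    assert (Hn : c <= n <= d) by (unfold n; lra).
    rewrite (oint_split_y f a b c n d) by (apply Hok; lra).
    rewrite (oint_split_x f a m b c n) by (apply Hok; lra).
    rewrite (oint_split_x f a m b n d) by (apply Hok; lra).
    eapply Rle_trans; [apply Cmod_triangle|].
    apply Rplus_le_compat; apply Cmod_triangle.
  - intros p Hp eps He.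
    destruct (oint_local f p (Hf p Hp) eps He) as [d [Hd K]].
    exists d; split; [exact Hd|]; intros; apply K; auto.
Qed.

(** * Cauchy's integral formula *)

(** Outside a small square around its only singularity, the function contributes
    nothing to the integral, by Goursat's theorem on the four remaining pieces. *)
Lemma oint_excision (f : C -> C) (z : C) (x0 x1 y0 y1 e : R) :
  0 < e -> x0 <= fst z - e -> fst z + e <= x1 -> y0 <= snd z - e -> snd z + e <= y1 ->
  (forall w, in_rect x0 x1 y0 y1 w -> w <> z -> cdiff f w) ->
  oint f x0 x1 y0 y1 = oint f (fst z - e) (fst z + e) (snd z - e) (snd z + e).
Proof.
  intros He X0 X1 Y0 Y1 Hf; destruct z as [p q]; simpl fst in *; simpl snd in *.
  assert (Hok : forall a b c d, x0 <= a <= b -> b <= x1 -> y0 <= c <= d -> d <= y1 ->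
    a <> p -> b <> p -> c <> q -> d <> q -> oint_ok f a b c d).
  { intros a b c d A B D E N1 N2 N3 N4; apply oint_ok_ccont; try lra.
    intros w [[Z1 Z2] Z3]; apply cdiff_ccont, Hf; [split; lra|].
    intros ->; simpl in Z3; intuition lra. }
  assert (H0 : forall a b c d, x0 <= a <= b -> b <= x1 -> y0 <= c <= d -> d <= y1 ->
    b < p \/ p < a \/ d < q \/ q < c -> oint f a b c d = 0).
  { intros a b c d A B D E N; apply goursat; try lra.
    intros w [Z1 Z2]; apply Hf; [split; lra|].
    intros ->; simpl in Z1, Z2; lra. }
  rewrite (oint_split_x f x0 (p - e) x1) by (apply Hok; lra).
  rewrite (oint_split_x f (p - e) (p + e) x1) by (apply Hok; lra).
  rewrite (oint_split_y f (p - e) (p + e) y0 (q - e) y1) by (apply Hok; lra).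
  rewrite (oint_split_y f (p - e) (p + e) (q - e) (q + e) y1) by (apply Hok; lra).
  rewrite (H0 x0 (p - e)), (H0 (p + e) x1), (H0 (p - e) (p + e) y0),
    (H0 (p - e) (p + e) (q + e) y1) by (lra || (right; right; (right + left); lra)).
  ring.
Qed.

Lemma Cint_real (c : C) (k : R -> R) (a b l : R) :
  is_RInt k a b l ->
  ex_Cint (fun t => c * RtoC (k t))%C a b /\
  Cint (fun t => c * RtoC (k t))%C a b = (c * RtoC l)%C.
Proof.
  intro H.
  assert (K : @is_RInt C_R_NormedModule (fun t => RtoC (k t)) a b (RtoC l)).
  { apply (@is_RInt_fct_extend_pair R_NormedModule R_NormedModule
             (fun t => RtoC (k t)) a b); simpl; [exact H|].
    assert (Z := @is_RInt_const R_NormedModule a b zero).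
    rewrite (@scal_zero_r R_Ring R_NormedModule) in Z; exact Z. }
  assert (K' := is_Cint_scal c _ _ _ _ K).
  split; [now exists (c * RtoC l)%C|].
  exact (@is_RInt_unique C_R_CompleteNormedModule _ a b _ K').
Qed.

Lemma is_RInt_atan_kernel (p e : R) : 0 < e ->
  is_RInt (fun x => 2 * e / ((x - p) ^ 2 + e ^ 2)) (p - e) (p + e) PI.
Proof.
  intros He.
  assert (Hd : forall x, 0 < (x - p) ^ 2 + e ^ 2).
  { intro x; generalize (pow2_ge_0 (x - p)) (pow_lt e 2 He); lra. }
  replace PI with (minus (2 * atan ((p + e - p) / e)) (2 * atan ((p - e - p) / e))).
  - apply (is_RInt_derive (fun x => 2 * atan ((x - p) / e))).
    + intros x _; auto_derive; [exact I|].
      specialize (Hd x). field; lra.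
    + intros x _; apply (@ex_derive_continuous R_AbsRing R_NormedModule).
      auto_derive; specialize (Hd x); simpl in Hd; lra.
  - replace ((p + e - p) / e) with 1 by (field; lra).
    replace ((p - e - p) / e) with (- (1)) by (field; lra).
    unfold minus, plus, opp; simpl.
    rewrite atan_opp, atan_1; lra.
Qed.

(** Opposite edges are integrated together: the difference of the two values of the
    kernel is [2 e / (x ^ 2 + e ^ 2)] up to a constant factor, which integrates to
    [PI]. *)
Lemma oint_inv_square (z : C) (e : R) : 0 < e ->
  oint (fun w => / (w - z))%C (fst z - e) (fst z + e) (snd z - e) (snd z + e)
  = (2 * RtoC PI * Ci)%C.
Proof.
  intros He; destruct z as [p q]; simpl fst; simpl snd.
  assert (Hok : oint_ok (fun w => / (w - (p, q)))%C (p - e) (p + e) (q - e) (q + e)).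
  { apply oint_ok_ccont; try lra; intros w [_ Hw]; apply ccont_inv_sub.
    intros ->; simpl in Hw; lra. }
  destruct Hok as (_ & _ & A1 & A2 & A3 & A4); unfold oint.
  destruct (Cint_real Ci _ _ _ _ (is_RInt_atan_kernel p e He)) as [E1 E1'].
  destruct (Cint_real 1 _ _ _ _ (is_RInt_atan_kernel q e He)) as [E2 E2'].
  assert (Hi : (Ci * Ci)%C = (-1)%R) by
    (unfold Ci, Cmult, RtoC; simpl; f_equal; ring).
  assert (Hdist : forall u, u ^ 2 + e ^ 2 <> 0).
  { intro u; generalize (pow2_ge_0 u) (pow_lt e 2 He); lra. }
  assert (Hne : forall u v : R, u <> 0 \/ v <> 0 -> (RtoC u + Ci * RtoC v)%C <> 0).
  { intros u v Huv E; apply (f_equal fst) in E as F; apply (f_equal snd) in E.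
    simpl in E, F; lra. }
  assert (Hpq : forall x y, ((x, y) - (p, q))%C = (RtoC (x - p) + Ci * RtoC (y - q))%C).
  { intros; unfold RtoC, Cminus, Copp, Cplus, Cmult, Ci; simpl; f_equal; ring. }
  assert (Hinv : forall u v : R, u ^ 2 + v ^ 2 <> 0 ->
     (/ (RtoC u + Ci * RtoC v))%C = ((u - Ci * v) * / RtoC (u ^ 2 + v ^ 2))%C).
  { intros u v Huv.
    assert (N : (RtoC u + Ci * RtoC v)%C <> 0).
    { apply Hne. destruct (Req_dec_T u 0) as [->|]; [|now left].
      destruct (Req_dec_T v 0) as [->|]; [|now right]. exfalso; apply Huv; ring. }
    assert (N2 : RtoC (u ^ 2 + v ^ 2) <> 0) by (intro E; apply Huv; now apply RtoC_inj).
    transitivity (/ (u + Ci * v)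
       * ((u + Ci * v) * ((u - Ci * v) * / RtoC (u ^ 2 + v ^ 2))))%C.
    2: { rewrite Cmult_assoc, Cinv_l by exact N; ring. }
    replace ((u + Ci * v) * ((u - Ci * v) * / RtoC (u ^ 2 + v ^ 2)))%C
      with ((u * u - (Ci * Ci) * (v * v)) * / RtoC (u ^ 2 + v ^ 2))%C by ring.
    rewrite Hi.
    replace (u * u - (-1)%R * (v * v))%C with (RtoC (u ^ 2 + v ^ 2)).
    - rewrite Cinv_r by exact N2; ring.
    - rewrite RtoC_plus, !RtoC_pow; simpl; ring. }
  assert (F1 : Cint (fun x => (/ ((x, (q - e)%R) - (p, q)))%C) (p - e) (p + e)
     = (Cint (fun x => (/ ((x, (q + e)%R) - (p, q)))%C) (p - e) (p + e) + Ci * RtoC PI)%C).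
  { rewrite <- E1', <- (proj2 (Cint_plus _ _ _ _ A2 E1)).
    apply Cint_ext; [lra|]; intros t _; rewrite !Hpq.
    replace (q - e - q) with (- e) by ring; replace (q + e - q) with e by ring.
    specialize (Hdist (t - p)).
    rewrite !Hinv by (auto; replace ((- e) ^ 2) with (e ^ 2) by ring; auto).
    replace ((- e) ^ 2) with (e ^ 2) by ring.
    unfold Rdiv; rewrite !RtoC_mult, RtoC_inv, RtoC_opp by exact Hdist. ring. }
  assert (F2 : Cint (fun y => (/ (((p + e)%R, y) - (p, q)))%C) (q - e) (q + e)
     = (Cint (fun y => (/ (((p - e)%R, y) - (p, q)))%C) (q - e) (q + e) + 1 * RtoC PI)%C).
  { rewrite <- E2', <- (proj2 (Cint_plus _ _ _ _ A3 E2)).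
    apply Cint_ext; [lra|]; intros t _; rewrite !Hpq.
    replace (p - e - p) with (- e) by ring; replace (p + e - p) with e by ring.
    specialize (Hdist (t - q)).
    rewrite !Hinv by (rewrite Rplus_comm; auto; replace ((- e) ^ 2) with (e ^ 2) by ring; auto).
    replace ((- e) ^ 2 + (t - q) ^ 2) with ((t - q) ^ 2 + e ^ 2) by ring.
    replace (e ^ 2 + (t - q) ^ 2) with ((t - q) ^ 2 + e ^ 2) by ring.
    unfold Rdiv; rewrite !RtoC_mult, RtoC_inv, RtoC_opp by exact Hdist. ring. }
  rewrite F1, F2; ring.
Qed.

Lemma eq_0_of_le_linear (a : C) (K : R) (e0 : R) : 0 < e0 ->
  (forall e, 0 < e < e0 -> Cmod a <= K * e) -> a = 0.
Proof.
  intros He H; apply Cmod_eq_0, Rle_antisym; [|apply Cmod_ge_0].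
  apply Rnot_lt_le; intro Hp.
  set (K' := Rabs K + 1).
  assert (HK : 0 < K') by (generalize (Rabs_pos K); unfold K'; lra).
  assert (HKK : K < K') by (generalize (Rle_abs K); unfold K'; lra).
  set (e := Rmin (e0 / 2) (Cmod a / (2 * K'))).
  assert (P1 : 0 < e) by (apply Rmin_pos; [lra|apply Rdiv_lt_0_compat; lra]).
  assert (P2 : e <= e0 / 2) by apply Rmin_l.
  assert (P3 : e <= Cmod a / (2 * K')) by apply Rmin_r.
  specialize (H e ltac:(lra)).
  assert (K * e < K' * e) by (apply Rmult_lt_compat_r; lra).
  assert (K' * e <= K' * (Cmod a / (2 * K'))) by (apply Rmult_le_compat_l; lra).
  replace (K' * (Cmod a / (2 * K'))) with (Cmod a / 2) in * by (field; lra).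
  lra.
Qed.

(** The difference quotient of [f] at [z] is bounded near [z], so its integral over
    a square around [z] tends to zero with the square; by excision the integral
    over the whole boundary vanishes. What remains is [f z] times the integral of
    the kernel. *)
Lemma cauchy_formula (f : C -> C) (z : C) (x0 x1 y0 y1 : R) :
  x0 < fst z < x1 -> y0 < snd z < y1 ->
  (forall w, in_rect x0 x1 y0 y1 w -> cdiff f w) ->
  oint (fun w => f w * / (w - z))%C x0 x1 y0 y1 = (2 * RtoC PI * Ci * f z)%C.
Proof.
  intros Hx Hy Hf.
  set (e0 := Rmin (Rmin (fst z - x0) (x1 - fst z)) (Rmin (snd z - y0) (y1 - snd z))).
  assert (He0 : 0 < e0) by (repeat apply Rmin_pos; lra).
  assert (Hb : e0 <= fst z - x0 /\ e0 <= x1 - fst z /\ e0 <= snd z - y0 /\ e0 <= y1 - snd z).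
  { unfold e0; repeat apply Rmin_case_strong; lra. }
  assert (Hinv : forall w, w <> z -> cdiff (fun w => / (w - z))%C w).
  { intros w Hw. assert (H := cdiff_quotient (fun _ => RtoC 1) 0 z w Hw (cdiff_const 1 w)).
    destruct H as [phi [Hp [d [Hd E]]]]; exists phi; split; [exact Hp|].
    exists d; split; [exact Hd|]; intros v Hv; specialize (E v Hv); unfold Cdiv in E.
    replace (/ (v - z))%C with ((1 - 0) * / (v - z))%C by ring.
    rewrite E; ring. }
  set (q := fun w => ((f w - f z) / (w - z))%C).
  assert (Hq : forall w, in_rect x0 x1 y0 y1 w -> w <> z -> cdiff q w).
  { intros w Hw Hne; apply cdiff_quotient; auto. }
  assert (Hoff : forall w, on_edges x0 x1 y0 y1 w -> w <> z).
  { intros w [_ Hw] ->; lra. }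
  assert (Q0 : oint q x0 x1 y0 y1 = 0).
  { destruct (Hf z) as [phi [Hphi [d1 [Hd1 E]]]]; [split; lra|].
    destruct (Hphi 1 ltac:(lra)) as [d2 [Hd2 K]].
    set (d := Rmin e0 (Rmin d1 d2 / 2)).
    assert (D0 : 0 < d).
    { apply Rmin_pos; [exact He0|]. assert (0 < Rmin d1 d2) by (now apply Rmin_pos); lra. }
    assert (D1 : d <= e0) by apply Rmin_l.
    assert (D2 : d <= Rmin d1 d2 / 2) by apply Rmin_r.
    assert (D3 : Rmin d1 d2 <= d1) by apply Rmin_l.
    assert (D4 : Rmin d1 d2 <= d2) by apply Rmin_r.
    apply (eq_0_of_le_linear _ (8 * (Cmod (phi z) + 1)) (d / 2)); [lra|].
    intros e He.
    rewrite (oint_excision q z x0 x1 y0 y1 e) by (lra || exact Hq).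
    assert (Hne : forall w, on_edges (fst z - e) (fst z + e) (snd z - e) (snd z + e) w -> w <> z).
    { intros w [_ Hw] ->; lra. }
    apply Rle_trans with
      (2 * (fst z + e - (fst z - e) + (snd z + e - (snd z - e))) * (Cmod (phi z) + 1));
      [|right; ring].
    apply oint_bound.
    - apply oint_ok_ccont; try lra; intros w Hw; apply cdiff_ccont, Hq; [|auto].
      destruct Hw as [[W1 W2] _]; split; lra.
    - intros w Hw.
      assert (Hwz : Cmod (w - z) <= 4 * e).
      { eapply Rle_trans; [apply (in_rect_diam _ _ _ _ _ _ (proj1 Hw))|].
        - split; lra.
        - right; ring. }
      assert (Hn := Cmod_pos_neq _ _ (Cmod_sub_pos _ _ (Hne w Hw))).
      unfold q; rewrite E by lra.
      replace ((f z + phi w * (w - z) - f z) / (w - z))%C with (phi w)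
        by (field; exact Hn).
      assert (T := Cmod_triangle_sub (phi w) (phi z) 0).
      replace (phi w - 0)%C with (phi w) in T by ring.
      replace (phi z - 0)%C with (phi z) in T by ring.
      specialize (K w ltac:(lra)); lra. }
  assert (Hokq : oint_ok q x0 x1 y0 y1).
  { apply oint_ok_ccont; try lra; intros w Hw; apply cdiff_ccont, Hq; [apply Hw|auto]. }
  assert (Hoki : oint_ok (fun w => / (w - z))%C x0 x1 y0 y1).
  { apply oint_ok_ccont; try lra; intros w Hw; apply ccont_inv_sub; auto. }
  assert (Hokf : oint_ok (fun w => f z * / (w - z))%C x0 x1 y0 y1).
  { apply oint_ok_ccont; try lra; intros w Hw.
    apply ccont_mult; [apply ccont_const|apply ccont_inv_sub; auto]. }
  rewrite (oint_ext _ (fun w => q w + f z * / (w - z))%C).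
  - rewrite oint_plus, oint_scal, Q0 by assumption.
    rewrite (oint_excision _ z x0 x1 y0 y1 (e0 / 2)) by (lra || auto).
    rewrite oint_inv_square by lra; ring.
  - lra.
  - lra.
  - intros w Hw; unfold q; field; apply Cmod_pos_neq, Cmod_sub_pos; auto.
Qed.

(** * Local factorization *)

Lemma least_nat (P : nat -> Prop) :
  (exists n, P n) -> exists n, P n /\ forall k, (k < n)%nat -> ~ P k.
Proof.
  intros [n Hn]; apply NNPP; intro H.
  assert (A : forall m k, (k < m)%nat -> ~ P k).
  { induction m as [|m IH]; intros k Hk HP; [lia|].
    destruct (Nat.eq_dec k m) as [->|]; [|now apply (IH k); [lia|]].
    apply H; exists m; split; auto. }
  now apply (A (S n) n); [lia|].
Qed.

Definition csquare (a : C) (rho : R) : C -> Prop :=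
  in_rect (fst a - rho) (fst a + rho) (snd a - rho) (snd a + rho).

Lemma edge_dist (a z : C) (rho : R) :
  on_edges (fst a - rho) (fst a + rho) (snd a - rho) (snd a + rho) z ->
  rho <= Cmod (z - a).
Proof.
  intros [_ H]; assert (K := Rmax_Cmod (z - a)%C).
  destruct z as [x y], a as [p q]; simpl in *.
  generalize (Rmax_l (Rabs (x + - p)) (Rabs (y + - q)))
    (Rmax_r (Rabs (x + - p)) (Rabs (y + - q)))
    (Rle_abs (x + - p)) (Rle_abs (y + - q))
    (Rle_abs (- (x + - p))) (Rle_abs (- (y + - q))).
  rewrite !Rabs_Ropp; lra.
Qed.

Section CauchyRemainders.

Variables (h : C -> C) (a : C) (rho M : R).
Hypotheses (Hrho : 0 < rho) (Hh : forall z, csquare a rho z -> cdiff h z)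
  (HM : forall z, csquare a rho z -> Cmod (h z) <= M).

Let bint (f : C -> C) : C :=
  oint f (fst a - rho) (fst a + rho) (snd a - rho) (snd a + rho).
Let edge := on_edges (fst a - rho) (fst a + rho) (snd a - rho) (snd a + rho).

(** Up to the factor [2 pi i], the part of degree at least [N] of the Taylor
    expansion of [h] at [a], divided by [(z - a) ^ N]; its value at [a] is the
    coefficient of degree [N]. Working with these integrals replaces power series
    by finite expansions. *)
Definition taylor_rest (N : nat) (z : C) : C :=
  oint (fun w => h w * / (w - z) * (/ (w - a)) ^ N)%C
    (fst a - rho) (fst a + rho) (snd a - rho) (snd a + rho).

Lemma edge_far (z w : C) : Cmod (z - a) < rho / 2 -> edge w -> rho / 2 <= Cmod (w - z).
Proof.
  intros Hz Hw; apply edge_dist in Hw.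
  assert (T := Cmod_triangle_sub w z a); lra.
Qed.

Lemma edge_neq (z w : C) : Cmod (z - a) < rho / 2 -> edge w -> w <> z.
Proof.
  intros Hz Hw ->; assert (T := edge_far z z Hz Hw).
  replace (z - z)%C with (RtoC 0) in T by ring; rewrite Cmod_0 in T; lra.
Qed.

Lemma center_near : Cmod (a - a) < rho / 2.
Proof. replace (a - a)%C with (RtoC 0) by ring; rewrite Cmod_0; lra. Qed.

Lemma edge_pow_bound (w : C) (N : nat) : edge w -> Cmod ((/ (w - a)) ^ N) <= (/ rho) ^ N.
Proof.
  intro Hw; rewrite Cmod_pow, Cmod_inv
    by (apply Cmod_pos_neq, Cmod_sub_pos, edge_neq; [apply center_near|exact Hw]).
  apply edge_dist in Hw; apply pow_incr; split.
  - left; apply Rinv_0_lt_compat; lra.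
  - apply Rinv_le_contravar; lra.
Qed.

Lemma edge_inv_bound (z w : C) : Cmod (z - a) < rho / 2 -> edge w ->
  Cmod (/ (w - z)) <= 2 / rho.
Proof.
  intros Hz Hw; rewrite Cmod_inv
    by (apply Cmod_pos_neq, Cmod_sub_pos, edge_neq; auto).
  replace (2 / rho) with (/ (rho / 2)) by (field; lra).
  apply Rinv_le_contravar; [lra|now apply edge_far].
Qed.

Lemma kernel_ok (N : nat) (k : C -> C) :
  (forall w, edge w -> ccont k w) ->
  oint_ok (fun w => h w * k w * (/ (w - a)) ^ N)%C
    (fst a - rho) (fst a + rho) (snd a - rho) (snd a + rho).
Proof.
  intros Hk; apply oint_ok_ccont; try lra; intros w Hw.
  apply ccont_mult; [apply ccont_mult|].
  - apply cdiff_ccont, Hh, Hw.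
  - apply Hk, Hw.
  - apply ccont_pow, ccont_inv_sub, edge_neq; [apply center_near|exact Hw].
Qed.

Lemma kernel_bound (N : nat) (k : C -> C) (B : R) :
  (forall w, edge w -> ccont k w) -> (forall w, edge w -> Cmod (k w) <= B) ->
  Cmod (bint (fun w => h w * k w * (/ (w - a)) ^ N)%C) <= 8 * rho * (M * B * (/ rho) ^ N).
Proof.
  intros Hk HB.
  apply Rle_trans with (2 * (fst a + rho - (fst a - rho) + (snd a + rho - (snd a - rho)))
                         * (M * B * (/ rho) ^ N)); [|right; ring].
  assert (Hok := kernel_ok N k Hk).
  unfold bint. refine (oint_bound _ _ _ _ _ _ Hok _).
  intros w Hw; rewrite !Cmod_mult.
  apply Rmult_le_compat; [|apply Cmod_ge_0| |now apply edge_pow_bound].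
  - apply Rmult_le_pos; apply Cmod_ge_0.
  - apply Rmult_le_compat; try apply Cmod_ge_0; [apply HM, Hw|now apply HB].
Qed.

(** Partial fractions under the integral. Taking [w = a] gives the recursion of the
    Taylor expansion; bounding the integral gives the Lipschitz estimate. *)
Lemma taylor_rest_sub (N : nat) (z w : C) :
  Cmod (z - a) < rho / 2 -> Cmod (w - a) < rho / 2 ->
  taylor_rest N z
  = (taylor_rest N w
     + (z - w) * bint (fun u => h u * (/ (u - z) * / (u - w)) * (/ (u - a)) ^ N))%C.
Proof.
  intros Hz Hw; unfold taylor_rest, bint.
  assert (Kz : forall u, edge u -> ccont (fun u => / (u - z))%C u)
    by (intros; apply ccont_inv_sub; now apply edge_neq).
  assert (Kw : forall u, edge u -> ccont (fun u => / (u - w))%C u)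
    by (intros; apply ccont_inv_sub; now apply edge_neq).
  assert (Kzw : forall u, edge u -> ccont (fun u => / (u - z) * / (u - w))%C u)
    by (intros; apply ccont_mult; auto).
  rewrite <- oint_scal by exact (kernel_ok N _ Kzw).
  rewrite <- oint_plus.
  - apply oint_ext; try lra; intros u Hu.
    assert ((u - z)%C <> 0) by (apply Cmod_pos_neq, Cmod_sub_pos, edge_neq; auto).
    assert ((u - w)%C <> 0) by (apply Cmod_pos_neq, Cmod_sub_pos, edge_neq; auto).
    set (X := ((/ (u - a)) ^ N)%C); field; auto.
  - exact (kernel_ok N _ Kw).
  - apply oint_ok_ccont; try lra; intros u Hu.
    apply ccont_mult; [apply ccont_const|].
    apply ccont_mult; [apply ccont_mult; [apply cdiff_ccont, Hh, Hu|now apply Kzw]|].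
    apply ccont_pow, ccont_inv_sub, edge_neq; [apply center_near|exact Hu].
Qed.

Lemma taylor_rest_S (N : nat) (z : C) : Cmod (z - a) < rho / 2 ->
  taylor_rest N z = (taylor_rest N a + (z - a) * taylor_rest (S N) z)%C.
Proof.
  intros Hz; rewrite (taylor_rest_sub N z a Hz center_near).
  replace (bint _) with (taylor_rest (S N) z); [reflexivity|].
  unfold bint, taylor_rest; apply oint_ext; try lra; intros u Hu; simpl; ring.
Qed.

Lemma taylor_rest_lipschitz (N : nat) (z w : C) :
  Cmod (z - a) < rho / 2 -> Cmod (w - a) < rho / 2 ->
  Cmod (taylor_rest N z - taylor_rest N w)
  <= 8 * rho * (M * (2 / rho * (2 / rho)) * (/ rho) ^ N) * Cmod (z - w).
Proof.
  intros Hz Hw; rewrite (taylor_rest_sub N z w Hz Hw).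
  set (b := bint _).
  replace (taylor_rest N w + (z - w) * b - taylor_rest N w)%C with (b * (z - w))%C by ring.
  rewrite Cmod_mult; apply Rmult_le_compat_r; [apply Cmod_ge_0|].
  unfold b; apply (kernel_bound N (fun u => / (u - z) * / (u - w))%C).
  - intros u Hu; apply ccont_mult; apply ccont_inv_sub; now apply edge_neq.
  - intros u Hu; rewrite Cmod_mult; apply Rmult_le_compat; try apply Cmod_ge_0;
    now apply edge_inv_bound.
Qed.

Lemma taylor_rest_bound (N : nat) (z : C) : Cmod (z - a) < rho / 2 ->
  Cmod (taylor_rest N z) <= 8 * rho * (M * (2 / rho) * (/ rho) ^ N).
Proof.
  intros Hz; apply (kernel_bound N (fun u => / (u - z))%C).
  - intros u Hu; apply ccont_inv_sub; now apply edge_neq.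
  - intros u Hu; now apply edge_inv_bound.
Qed.

Lemma taylor_rest_0 (z : C) : Cmod (z - a) < rho / 2 ->
  taylor_rest 0 z = (2 * RtoC PI * Ci * h z)%C.
Proof.
  intros Hz; rewrite <- (cauchy_formula h z (fst a - rho) (fst a + rho)
                           (snd a - rho) (snd a + rho)).
  - unfold taylor_rest; apply oint_ext; try lra; intros u Hu; simpl; ring.
  - assert (K := Rmax_Cmod (z - a)%C); destruct z as [x y], a as [p q]; simpl in *.
    generalize (Rmax_l (Rabs (x + - p)) (Rabs (y + - q)))
      (Rle_abs (x + - p)) (Rle_abs (- (x + - p))); rewrite Rabs_Ropp; lra.
  - assert (K := Rmax_Cmod (z - a)%C); destruct z as [x y], a as [p q]; simpl in *.
    generalize (Rmax_r (Rabs (x + - p)) (Rabs (y + - q)))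
      (Rle_abs (y + - q)) (Rle_abs (- (y + - q))); rewrite Rabs_Ropp; lra.
  - exact Hh.
Qed.

Lemma taylor_rest_vanish (n : nat) :
  (forall k, (k < n)%nat -> taylor_rest (S k) a = 0) ->
  forall z, Cmod (z - a) < rho / 2 ->
  (2 * RtoC PI * Ci * (h z - h a))%C = ((z - a) ^ S n * taylor_rest (S n) z)%C.
Proof.
  intros Hk z Hz.
  assert (A : taylor_rest 1 z = ((z - a) ^ n * taylor_rest (S n) z)%C).
  { induction n as [|n IH]; [simpl; ring|].
    rewrite IH by (intros; apply Hk; lia).
    rewrite (taylor_rest_S (S n) z Hz), Hk by lia; simpl; ring. }
  assert (B := taylor_rest_S 0 z Hz).
  rewrite (taylor_rest_0 z Hz), (taylor_rest_0 a center_near) in B.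
  replace (2 * RtoC PI * Ci * (h z - h a))%C
    with (2 * RtoC PI * Ci * h z - 2 * RtoC PI * Ci * h a)%C by ring.
  rewrite B, A; simpl; ring.
Qed.

End CauchyRemainders.

Lemma two_pi_i_neq_0 : (2 * RtoC PI * Ci)%C <> 0.
Proof.
  intro H; apply (f_equal snd) in H; simpl in H; generalize PI_RGT_0; lra.
Qed.

(** [S n] is the order of vanishing of [h - h a] at [a]. The Lipschitz bound on the
    unit [g] is all that the distortion estimates need from analyticity. *)
Definition has_order (h : C -> C) (a : C) (n : nat) : Prop :=
  exists (g : C -> C) (r L : R), 0 < r /\ 0 <= L /\ g a <> 0 /\
    (forall z, Cmod (z - a) < r -> h z = (h a + (z - a) ^ S n * g z)%C) /\
    (forall z w, Cmod (z - a) < r -> Cmod (w - a) < r ->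
       Cmod (g z - g w) <= L * Cmod (z - w)).

(** If some Taylor coefficient of positive degree is nonzero, the first one gives the
    order. Otherwise [h z - h a] equals its remainder of every degree, and on half
    the radius these remainders decay geometrically. *)
Lemma local_dichotomy (h : C -> C) (a : C) (r0 : R) :
  0 < r0 -> (forall z, csquare a r0 z -> cdiff h z) ->
  (exists r, 0 < r /\ forall z, Cmod (z - a) < r -> h z = h a) \/
  (exists n, has_order h a n).
Proof.
  intros Hr0 Hd0.
  assert (Ha : csquare a r0 a) by (split; lra).
  destruct (cdiff_ccont h a (Hd0 a Ha) 1 ltac:(lra)) as [d [Hd K]].
  (* The square of half-side [rho] has size [4 * rho < d], so [h] is bounded on it. *)
  set (rho := Rmin r0 (d / 5)).
  assert (Hrho : 0 < rho) by (apply Rmin_pos; lra).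
  assert (R1 : rho <= r0) by apply Rmin_l.
  assert (R2 : rho <= d / 5) by apply Rmin_r.
  set (M := Cmod (h a) + 1).
  assert (HM0 : 0 < M) by (generalize (Cmod_ge_0 (h a)); unfold M; lra).
  assert (Hh : forall z, csquare a rho z -> cdiff h z).
  { intros z [Z1 Z2]; apply Hd0; split; lra. }
  assert (HM : forall z, csquare a rho z -> Cmod (h z) <= M).
  { intros z Hz.
    assert (D := in_rect_diam _ _ _ _ z a Hz ltac:(split; lra)).
    specialize (K z ltac:(lra)).
    assert (T := Cmod_triangle (h z - h a) (h a)).
    replace (h z - h a + h a)%C with (h z) in T by ring; unfold M; lra. }
  set (T := taylor_rest h a rho).
  assert (Hpi := two_pi_i_neq_0).
  destruct (classic (exists n, T (S n) a <> 0)) as [Hex|Hnone].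
  - right; destruct (least_nat _ Hex) as [n [Hn Hleast]].
    assert (Hz : forall k, (k < n)%nat -> T (S k) a = 0).
    { intros k Hk; apply NNPP, Hleast, Hk. }
    exists n, (fun z => / (2 * RtoC PI * Ci) * T (S n) z)%C, (rho / 2).
    exists (Cmod (/ (2 * RtoC PI * Ci)) * (8 * rho * (M * (2 / rho * (2 / rho)) * (/ rho) ^ S n))).
    assert (P0 : 0 < / rho) by now apply Rinv_0_lt_compat.
    assert (P1 : 0 < (/ rho) ^ S n) by now apply pow_lt.
    repeat split.
    + lra.
    + apply Rmult_le_pos; [apply Cmod_ge_0|].
      set (X := (/ rho) ^ S n) in *; clearbody X; unfold Rdiv.
      left; repeat apply Rmult_lt_0_compat; lra.
    + apply Cmult_neq_0; [|exact Hn].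
      intro E; apply Hpi; rewrite <- (Cmult_1_l (2 * RtoC PI * Ci)).
      rewrite <- (Cinv_r (2 * RtoC PI * Ci)) at 1 by exact Hpi.
      rewrite E; ring.
    + intros z Hzr.
      assert (E := taylor_rest_vanish h a rho M Hrho Hh HM n Hz z Hzr); fold T in E.
      replace (h a + (z - a) ^ S n * (/ (2 * RtoC PI * Ci) * T (S n) z))%C
        with (h a + / (2 * RtoC PI * Ci) * ((z - a) ^ S n * T (S n) z))%C by ring.
      rewrite <- E, Cmult_assoc, Cinv_l by exact Hpi; ring.
    + intros z w Hzr Hwr.
      replace (/ (2 * RtoC PI * Ci) * T (S n) z - / (2 * RtoC PI * Ci) * T (S n) w)%C
        with (/ (2 * RtoC PI * Ci) * (T (S n) z - T (S n) w))%C by ring.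
      rewrite Cmod_mult, Rmult_assoc; apply Rmult_le_compat_l; [apply Cmod_ge_0|].
      now apply (taylor_rest_lipschitz h a rho M).
  - left; exists (rho / 2); split; [lra|]; intros z Hzr.
    assert (Hz : forall n, T (S n) a = 0).
    { intro n; apply NNPP; intro E; apply Hnone; now exists n. }
    enough (E : (2 * RtoC PI * Ci * (h z - h a))%C = 0).
    { replace (h z) with (h a + / (2 * RtoC PI * Ci) * (2 * RtoC PI * Ci * (h z - h a)))%C
        by (rewrite Cmult_assoc, Cinv_l by exact Hpi; ring).
      rewrite E; ring. }
    apply Cmod_eq_0, Rle_antisym; [|apply Cmod_ge_0].
    apply Rnot_lt_le; intro Hp.
    set (q := Cmod (2 * RtoC PI * Ci * (h z - h a))) in *.
    destruct (pow_lt_1_zero (/ 2)) with (y := q / (16 * M)) as [N HN].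
    { rewrite Rabs_pos_eq; lra. }
    { apply Rdiv_lt_0_compat; lra. }
    specialize (HN (S N) ltac:(lia)).
    rewrite Rabs_pos_eq in HN by (apply pow_le; lra).
    assert (E := taylor_rest_vanish h a rho M Hrho Hh HM N (fun k _ => Hz k) z Hzr).
    assert (B := taylor_rest_bound h a rho M Hrho Hh HM (S N) z Hzr).
    apply (f_equal Cmod) in E; fold q in E; rewrite Cmod_mult, Cmod_pow in E.
    assert (G : q <= (rho / 2) ^ S N * (8 * rho * (M * (2 / rho) * (/ rho) ^ S N))).
    { rewrite E; apply Rmult_le_compat; [apply pow_le, Cmod_ge_0|apply Cmod_ge_0| |exact B].
      apply pow_incr; split; [apply Cmod_ge_0|lra]. }
    replace ((rho / 2) ^ S N * (8 * rho * (M * (2 / rho) * (/ rho) ^ S N)))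
      with (16 * M * (/ 2) ^ S N) in G.
    + assert (16 * M * (/ 2) ^ S N < 16 * M * (q / (16 * M)))
        by (apply Rmult_lt_compat_l; lra).
      replace (16 * M * (q / (16 * M))) with q in * by (field; lra); lra.
    + unfold Rdiv at 1; rewrite Rpow_mult_distr.
      assert (F : rho ^ S N * (/ rho) ^ S N = 1).
      { rewrite <- Rpow_mult_distr, Rinv_r by lra; apply pow1. }
      replace (rho ^ S N * (/ 2) ^ S N * (8 * rho * (M * (2 / rho) * (/ rho) ^ S N)))
        with ((rho ^ S N * (/ rho) ^ S N) * (/ 2) ^ S N * (8 * rho * (M * (2 / rho)))) by ring.
      rewrite F; field; lra.
Qed.

(** * The identity theorem *)

Lemma open_Cmod (U : C -> Prop) :
  (forall a, U a -> exists r, 0 < r /\ forall w, Cmod (w - a) < r -> U w) ->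
  @open C_UniformSpace U.
Proof.
  intros H a Ha; destruct (H a Ha) as [r [Hr K]].
  exists (mkposreal (r / 2) ltac:(lra)); intros w Hw; apply K.
  apply (C_NormedModule_mixin_compat2 a w (mkposreal (r / 2) _)) in Hw.
  change (Cmod (w - a) < sqrt 2 * (r / 2)) in Hw.
  assert (sqrt 2 < 2).
  { rewrite <- (sqrt_Rsqr 2) at 2 by lra; apply sqrt_lt_1; unfold Rsqr; lra. }
  assert (sqrt 2 * (r / 2) < 2 * (r / 2)) by (apply Rmult_lt_compat_r; lra).
  lra.
Qed.

Lemma open_csquare (U : C -> Prop) (a : C) :
  @open C_UniformSpace U -> U a ->
  exists r, 0 < r /\ forall z, csquare a r z -> U z.
Proof.
  intros HU Ha; destruct (HU a Ha) as [r Hr].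
  exists (r / 2); assert (Hp := cond_pos r); split; [lra|].
  intros z [Z1 Z2]; apply Hr; split; apply Rabs_def1; simpl;
  unfold minus, plus, opp; simpl; lra.
Qed.

Lemma has_order_isolated (h : C -> C) (a : C) (n : nat) : has_order h a n ->
  exists r, 0 < r /\ forall z, Cmod (z - a) < r -> z <> a -> h z <> h a.
Proof.
  intros (g & r & L & Hr & HL & Hg & E & Lip).
  assert (Hb : 0 < Cmod (g a)) by now apply Cmod_gt_0.
  set (r' := Rmin r (Cmod (g a) / (L + 1))).
  assert (R0 : 0 < r') by (apply Rmin_pos; [lra|apply Rdiv_lt_0_compat; lra]).
  assert (R1 : r' <= r) by apply Rmin_l.
  assert (R2 : r' <= Cmod (g a) / (L + 1)) by apply Rmin_r.
  exists r'; split; [exact R0|]; intros z Hz Hne Heq.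
  rewrite E in Heq by lra.
  assert (Z : ((z - a) ^ S n * g z)%C = 0).
  { replace ((z - a) ^ S n * g z)%C with (h a + (z - a) ^ S n * g z - h a)%C by ring.
    rewrite Heq; ring. }
  assert (P : (z - a)%C <> 0) by now apply Cmod_pos_neq, Cmod_sub_pos.
  assert (G : g z = 0).
  { apply NNPP; intro G; now apply (Cmult_neq_0 _ _ (Cpow_nz _ (S n) P) G). }
  assert (A := Lip z a ltac:(lra)).
  replace (a - a)%C with (RtoC 0) in A by ring; rewrite Cmod_0 in A.
  specialize (A Hr); rewrite G in A.
  replace (0 - g a)%C with (- g a)%C in A by ring; rewrite Cmod_opp in A.
  assert (B : L * Cmod (z - a) <= L * (Cmod (g a) / (L + 1)))
    by (apply Rmult_le_compat_l; lra).
  assert (D : Cmod (g a) = L * (Cmod (g a) / (L + 1)) + Cmod (g a) / (L + 1)) by (field; lra).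
  lra.
Qed.

(** The points near which [h] is identically [h a] form an open set. So do the other
    points of the domain: near such a point [h] takes the value [h a] at that point
    at most, by continuity or by [has_order_isolated]. Connectedness excludes that
    both sets are nonempty, and a non-constant [h] excludes that the second is
    empty. *)
Lemma domain_has_order (Omega : C -> Prop) (h : C -> C) :
  is_domain Omega -> holomorphic_on Omega h -> ~ constant_on Omega h ->
  forall a, Omega a -> exists n, has_order h a n.
Proof.
  intros [Hopen [Hconn _]] Hhol Hnc a Ha.
  assert (Hdich : forall z, Omega z ->
    (exists r, 0 < r /\ forall w, Cmod (w - z) < r -> h w = h z) \/
    (exists n, has_order h z n)).
  { intros z Hz; destruct (open_csquare Omega z Hopen Hz) as [r [Hr K]].
    apply (local_dichotomy h z r Hr); intros w Hw.
    apply ex_derive_cdiff, Hhol, K, Hw. }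
  assert (Hnbhd : forall z, Omega z -> exists r, 0 < r /\ forall w, Cmod (w - z) < r -> Omega w).
  { intros z Hz; destruct (open_csquare Omega z Hopen Hz) as [r [Hr K]].
    exists r; split; [exact Hr|]; intros w Hw; apply K.
    assert (T := Rmax_Cmod (w - z)%C); destruct w as [u v], z as [p q]; unfold csquare, in_rect.
    simpl in *.
    generalize (Rmax_l (Rabs (u + - p)) (Rabs (v + - q)))
      (Rmax_r (Rabs (u + - p)) (Rabs (v + - q)))
      (Rle_abs (u + - p)) (Rle_abs (v + - q))
      (Rle_abs (- (u + - p))) (Rle_abs (- (v + - q))).
    rewrite !Rabs_Ropp; lra. }
  destruct (Hdich a Ha) as [Hflat|]; [exfalso|assumption].
  set (flat := fun z => exists r, 0 < r /\ forall w, Cmod (w - z) < r -> h w = h a).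
  assert (Oflat : @open C_UniformSpace flat).
  { apply open_Cmod; intros z [r [Hr K]].
    exists (r / 2); split; [lra|]; intros w Hw.
    exists (r / 2); split; [lra|]; intros v Hv; apply K.
    assert (T := Cmod_triangle_sub v w z); lra. }
  assert (Orest : @open C_UniformSpace (fun z => Omega z /\ ~ flat z)).
  { apply open_Cmod; intros z [Hz Hn].
    destruct (Hnbhd z Hz) as [r1 [Hr1 K1]].
    enough (exists r, 0 < r /\ forall w, Cmod (w - z) < r -> w <> z -> h w <> h a)
      as [r [Hr K]].
    { exists (Rmin r r1); split; [now apply Rmin_pos|]; intros w Hw.
      assert (Rmin r r1 <= r) by apply Rmin_l.
      assert (Rmin r r1 <= r1) by apply Rmin_r.
      split; [apply K1; lra|]; intros [r2 [Hr2 K2]].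
      destruct (C_eq_dec w z) as [->|Hne].
      - apply Hn; now exists r2.
      - apply (K w); [lra|exact Hne|]; apply K2.
        replace (w - w)%C with (RtoC 0) by ring; rewrite Cmod_0; lra. }
    destruct (C_eq_dec (h z) (h a)) as [Heq|Hne].
    - destruct (Hdich z Hz) as [Hf|[n Hord]].
      + exfalso; apply Hn; destruct Hf as [r [Hr K]].
        exists r; split; [exact Hr|]; intros; rewrite <- Heq; auto.
      + destruct (has_order_isolated h z n Hord) as [r [Hr K]].
        exists r; split; [exact Hr|]; intros w Hw Hwz; rewrite <- Heq; auto.
    - assert (Hcont : ccont h z) by now apply cdiff_ccont, ex_derive_cdiff, Hhol.
      destruct (Hcont (Cmod (h z - h a)) (Cmod_sub_pos _ _ Hne)) as [r [Hr K]].
      exists r; split; [exact Hr|]; intros w Hw _ Heq.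
      specialize (K w Hw); rewrite Heq, Cmod_sub_sym in K; lra. }
  apply Hnc; exists (h a); intros z Hz; apply NNPP; intro Hne.
  destruct (Hconn flat (fun z => Omega z /\ ~ flat z) Oflat Orest) as [x [_ [F [_ NF]]]].
  - intros x Hx; destruct (classic (flat x)); auto.
  - exists a; split; [exact Ha|exact Hflat].
  - exists z; split; [exact Hz|]; split; [exact Hz|]; intros [r [Hr K]].
    apply Hne, K; replace (z - z)%C with (RtoC 0) by ring; rewrite Cmod_0; lra.
  - exact (NF F).
Qed.

(** * Metric distortion near a point of given order *)

Lemma Cpow_sub_bound (u v : C) (s : R) (n : nat) : Cmod u <= s -> Cmod v <= s ->
  Cmod (u ^ S n - v ^ S n) <= INR (S n) * s ^ n * Cmod (u - v).
Proof.
  intros Hu Hv.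
  assert (Hs : 0 <= s) by (generalize (Cmod_ge_0 u); lra).
  induction n as [|n IH].
  - simpl; rewrite !Cmult_1_r; lra.
  - replace (u ^ S (S n) - v ^ S (S n))%C
      with (u * (u ^ S n - v ^ S n) + (u - v) * v ^ S n)%C by (simpl; ring).
    eapply Rle_trans; [apply Cmod_triangle|].
    rewrite !Cmod_mult, Cmod_pow, (S_INR (S n)).
    assert (A : Cmod u * Cmod (u ^ S n - v ^ S n)
                <= s * (INR (S n) * s ^ n * Cmod (u - v)))
      by (apply Rmult_le_compat; auto using Cmod_ge_0).
    assert (B : Cmod (u - v) * Cmod v ^ S n <= Cmod (u - v) * s ^ S n).
    { apply Rmult_le_compat_l; [apply Cmod_ge_0|].
      apply pow_incr; split; [apply Cmod_ge_0|exact Hv]. }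
    replace ((INR (S n) + 1) * s ^ S n * Cmod (u - v))
      with (s * (INR (S n) * s ^ n * Cmod (u - v)) + Cmod (u - v) * s ^ S n)
      by (simpl; ring).
    lra.
Qed.

(** The factor [s] on the left avoids the exponent [n - 1] on the right. *)
Lemma Cpow_linear_error (u v : C) (s : R) (n : nat) : Cmod u <= s -> Cmod v <= s ->
  s * Cmod (u ^ S n - v ^ S n - INR (S n) * v ^ n * (u - v))
  <= INR (S n) ^ 2 * s ^ n * Cmod (u - v) ^ 2.
Proof.
  intros Hu Hv.
  assert (Hs : 0 <= s) by (generalize (Cmod_ge_0 u); lra).
  induction n as [|n IH].
  - replace (u ^ 1 - v ^ 1 - INR 1 * v ^ 0 * (u - v))%C with (RtoC 0)
      by (simpl; ring).
    rewrite Cmod_0, Rmult_0_r; simpl; generalize (Cmod_ge_0 (u - v)); nra.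
  - set (k := INR (S n)) in *.
    assert (Hk : 0 <= k) by apply pos_INR.
    rewrite (S_INR (S n)); fold k.
    set (X := (u ^ S n - v ^ S n - k * v ^ n * (u - v))%C) in *.
    replace (u ^ S (S n) - v ^ S (S n) - RtoC (k + 1) * v ^ S n * (u - v))%C
      with (u * X + k * v ^ n * ((u - v) * (u - v)))%C
      by (unfold X; rewrite RtoC_plus; simpl; ring).
    assert (A : Cmod (u * X + k * v ^ n * ((u - v) * (u - v)))
                <= s * Cmod X + k * s ^ n * Cmod (u - v) ^ 2).
    { eapply Rle_trans; [apply Cmod_triangle|].
      rewrite !Cmod_mult, Cmod_R, (Rabs_pos_eq k), Cmod_pow by exact Hk.
      apply Rplus_le_compat.
      - apply Rmult_le_compat_r; [apply Cmod_ge_0|exact Hu].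
      - simpl; rewrite Rmult_1_r.
        apply Rmult_le_compat_r; [apply Rmult_le_pos; apply Cmod_ge_0|].
        apply Rmult_le_compat_l; [exact Hk|].
        apply pow_incr; split; [apply Cmod_ge_0|exact Hv]. }
    set (D := Cmod (u - v) ^ 2) in *.
    assert (HD : 0 <= D) by apply pow2_ge_0.
    assert (Hsn : 0 <= s ^ n) by now apply pow_le.
    eapply Rle_trans; [apply Rmult_le_compat_l; [exact Hs|exact A]|].
    apply Rle_trans with (s * (k ^ 2 * s ^ n * D + k * s ^ n * D)).
    + apply Rmult_le_compat_l; [exact Hs|lra].
    + replace (s * (k ^ 2 * s ^ n * D + k * s ^ n * D))
        with ((k ^ 2 + k) * (s * s ^ n * D)) by ring.
      replace ((k + 1) ^ 2 * s ^ S n * D) with ((k + 1) ^ 2 * (s * s ^ n * D))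
        by (simpl; ring).
      apply Rmult_le_compat_r; [apply Rmult_le_pos; [apply Rmult_le_pos|]; assumption|nra].
Qed.

(** Near [a] the map distorts distances like the power of exponent [S n]: by a factor
    of order [s ^ n] at distance [s] from [a]. The upper bound holds on the whole
    disc of radius [s]; the lower bound needs points of an annulus that are close to
    each other on the scale [s], since the power map is not injective. The annulus
    of ratio 64 and the limit [8 * r] on its outer radius are those met in
    [transfer_far_from_center]. *)
Lemma has_order_estimates (h : C -> C) (a : C) (n : nat) : has_order h a n ->
  exists r b K d c, 0 < r /\ 0 < b /\ 0 < K /\ 0 < d /\ 0 < c /\ c <= K /\
  (forall z, Cmod (z - a) < r ->
     b * Cmod (z - a) ^ S n <= Cmod (h z - h a) <= 4 * b * Cmod (z - a) ^ S n) /\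
  (forall z w s, Cmod (z - a) < r -> Cmod (w - a) < r ->
     Cmod (z - a) <= s -> Cmod (w - a) <= s ->
     Cmod (h z - h w) <= K * s ^ n * Cmod (z - w)) /\
  (forall z w s, Cmod (z - a) < r -> Cmod (w - a) < r -> 0 < s -> s <= 8 * r ->
     Cmod (z - a) <= s -> s / 64 <= Cmod (w - a) <= s -> Cmod (z - w) <= d * s ->
     c * s ^ n * Cmod (z - w) <= Cmod (h z - h w)).
Proof.
  intros (g & r0 & L & Hr0 & HL & Hg & E & Lip).
  assert (Hb : 0 < Cmod (g a)) by now apply Cmod_gt_0.
  set (B := Cmod (g a)) in *.
  set (t := (/ 64) ^ n).
  assert (Ht0 : 0 < t) by (apply pow_lt; lra).
  assert (Ht1 : t <= 1) by (unfold t; rewrite <- (pow1 n); apply pow_incr; lra).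
  set (m := INR (S n)).
  assert (Hm : 1 <= m) by (unfold m; rewrite S_INR; generalize (pos_INR n); lra).
  (* On this radius the variation of [g], at most [8 * L * r] at scale [s], stays
     below the lower bound obtained for the power with constant [g]. *)
  set (r := Rmin r0 (B * t / (64 * (L + 1)))).
  assert (R0 : 0 < r).
  { apply Rmin_pos; [exact Hr0|]; apply Rdiv_lt_0_compat; [|lra].
    now apply Rmult_lt_0_compat. }
  assert (R1 : r <= r0) by apply Rmin_l.
  assert (R2 : r <= B * t / (64 * (L + 1))) by apply Rmin_r.
  assert (R3 : L * r <= B * t / 64).
  { apply Rle_trans with ((L + 1) * (B * t / (64 * (L + 1)))); [|right; field; lra].
    apply Rmult_le_compat; lra. }
  assert (HBt : B * t <= B) by (rewrite <- (Rmult_1_r B) at 2; apply Rmult_le_compat_l; lra).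
  assert (Gb : forall z, Cmod (z - a) < r -> B / 2 <= Cmod (g z) <= 2 * B).
  { intros z Hz.
    assert (A := Lip z a ltac:(lra)).
    replace (a - a)%C with (RtoC 0) in A by ring; rewrite Cmod_0 in A; specialize (A Hr0).
    assert (A' : L * Cmod (z - a) <= L * r) by (apply Rmult_le_compat_l; lra).
    assert (T1 := Cmod_triangle (g z - g a) (g a)).
    replace (g z - g a + g a)%C with (g z) in T1 by ring.
    assert (T2 := Cmod_ge_minus (g a) (g z)).
    rewrite Cmod_sub_sym in T2; fold B in T1, T2; lra. }
  assert (Dec : forall z w, Cmod (z - a) < r -> Cmod (w - a) < r ->
    (h z - h w)%C = (((z - a) ^ S n - (w - a) ^ S n) * g z
                     + (w - a) ^ S n * (g z - g w))%C).
  { intros z w Hz Hw; rewrite (E z), (E w) by lra; ring. }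
  assert (K0 : 0 <= L * r) by (apply Rmult_le_pos; lra).
  assert (mB : B <= m * B) by (rewrite <- (Rmult_1_l B) at 1; apply Rmult_le_compat_r; lra).
  exists r, (B / 2), (m * (2 * B) + L * r), (t / (2 * m)), (B * t / 8).
  assert (BtP : 0 < B * t) by now apply Rmult_lt_0_compat.
  repeat match goal with |- _ /\ _ => split end; try lra.
  - apply Rdiv_lt_0_compat; lra.
  - intros z Hz; specialize (Gb z Hz); rewrite E by lra.
    replace (h a + (z - a) ^ S n * g z - h a)%C with ((z - a) ^ S n * g z)%C by ring.
    rewrite Cmod_mult, Cmod_pow.
    assert (P := pow_le (Cmod (z - a)) (S n) (Cmod_ge_0 _)).
    split.
    + rewrite Rmult_comm; apply Rmult_le_compat_l; lra.
    + rewrite (Rmult_comm (4 * (B / 2))); apply Rmult_le_compat_l; lra.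
  - intros z w s Hz Hw Hzs Hws; rewrite Dec by assumption.
    eapply Rle_trans; [apply Cmod_triangle|]; rewrite !Cmod_mult.
    assert (Hzw : (z - a - (w - a))%C = (z - w)%C) by ring.
    assert (Hs : 0 <= s) by (generalize (Cmod_ge_0 (z - a)); lra).
    assert (Hsn : 0 <= s ^ n) by now apply pow_le.
    assert (P := Cpow_sub_bound _ _ s n Hzs Hws); rewrite Hzw in P; fold m in P.
    assert (F1 : Cmod ((z - a) ^ S n - (w - a) ^ S n) * Cmod (g z)
                 <= m * s ^ n * Cmod (z - w) * (2 * B)).
    { apply Rmult_le_compat; try apply Cmod_ge_0; [exact P|apply Gb, Hz]. }
    assert (F2 : Cmod ((w - a) ^ S n) * Cmod (g z - g w)
                 <= (r * s ^ n) * (L * Cmod (z - w))).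
    { apply Rmult_le_compat; try apply Cmod_ge_0; [|apply Lip; lra].
      rewrite Cmod_pow; simpl; apply Rmult_le_compat; try apply Cmod_ge_0; try lra.
      - apply pow_le, Cmod_ge_0.
      - apply pow_incr; split; [apply Cmod_ge_0|exact Hws]. }
    replace ((m * (2 * B) + L * r) * s ^ n * Cmod (z - w))
      with (m * s ^ n * Cmod (z - w) * (2 * B) + r * s ^ n * (L * Cmod (z - w))) by ring.
    lra.
  - intros z w s Hz Hw Hs0 Hs8 Hzs [Hws1 Hws2] Hd; rewrite Dec by assumption.
    eapply Rle_trans; [|apply Cmod_ge_sub]; rewrite !Cmod_mult.
    assert (Hzw : (z - a - (w - a))%C = (z - w)%C) by ring.
    assert (Lzw := Lip z w ltac:(lra) ltac:(lra)).
    set (u := (z - a)%C) in *; set (v := (w - a)%C) in *.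
    set (x := Cmod (z - w)) in *.
    assert (Hx : 0 <= x) by apply Cmod_ge_0.
    assert (Hsn : 0 < s ^ n) by now apply pow_lt.
    assert (P := Cpow_linear_error u v s n Hzs Hws2); rewrite Hzw in P; fold m x in P.
    set (Y := (u ^ S n - v ^ S n - m * v ^ n * (z - w))%C) in *.
    (* [d = t / (2 * m)] makes the nonlinear part at most half of the linear one. *)
    assert (P' : Cmod Y <= m * t / 2 * (s ^ n * x)).
    { apply (Rmult_le_reg_l s); [exact Hs0|].
      eapply Rle_trans; [exact P|].
      replace (m ^ 2 * s ^ n * x ^ 2) with (m ^ 2 * s ^ n * x * x) by ring.
      replace (s * (m * t / 2 * (s ^ n * x)))
        with (m ^ 2 * s ^ n * x * (t / (2 * m) * s)) by (field; lra).
      apply Rmult_le_compat_l; [|exact Hd].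
      repeat apply Rmult_le_pos; lra || apply pow2_ge_0. }
    assert (V : t * s ^ n <= Cmod v ^ n).
    { unfold t; rewrite <- Rpow_mult_distr; apply pow_incr; lra. }
    assert (F0 : m * t * (s ^ n * x) <= Cmod (RtoC m * v ^ n * (z - w))).
    { rewrite !Cmod_mult, Cmod_R, Cmod_pow, Rabs_pos_eq by lra; fold x.
      replace (m * t * (s ^ n * x)) with (m * (t * s ^ n) * x) by ring.
      apply Rmult_le_compat_r; [exact Hx|]; apply Rmult_le_compat_l; lra. }
    assert (sx : 0 <= s ^ n * x) by (apply Rmult_le_pos; lra).
    assert (F1 : t / 2 * (s ^ n * x) <= Cmod (u ^ S n - v ^ S n)).
    { assert (A := Cmod_ge_sub (RtoC m * v ^ n * (z - w)) Y).
      replace (RtoC m * v ^ n * (z - w) + Y)%C with (u ^ S n - v ^ S n)%C in A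
        by (unfold Y; ring).
      assert (1 * (t / 2 * (s ^ n * x)) <= m * (t / 2 * (s ^ n * x))).
      { apply Rmult_le_compat_r; [|exact Hm]; apply Rmult_le_pos; lra. }
      lra. }
    assert (F2 : t / 2 * (s ^ n * x) * (B / 2) <= Cmod (u ^ S n - v ^ S n) * Cmod (g z)).
    { apply Rmult_le_compat; try lra; [|apply Gb, Hz]. apply Rmult_le_pos; lra. }
    assert (F3 : Cmod (v ^ S n) * Cmod (g z - g w) <= (8 * r * s ^ n) * (L * x)).
    { apply Rmult_le_compat; try apply Cmod_ge_0; [|exact Lzw].
      rewrite Cmod_pow; simpl; apply Rmult_le_compat; try apply Cmod_ge_0; try lra.
      - apply pow_le, Cmod_ge_0.
      - apply pow_incr; split; [apply Cmod_ge_0|exact Hws2]. }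
    assert (F4 : L * r * (s ^ n * x) <= B * t / 64 * (s ^ n * x))
      by (apply Rmult_le_compat_r; lra).
    lra.
Qed.

(** * Covering numbers *)

Lemma diam_le (A : C -> Prop) (r : R) :
  Rbar_le (diam A) (Finite r) <-> forall x y, A x -> A y -> Cmod (x - y) <= r.
Proof.
  unfold diam; destruct (Lub_Rbar_correct
    (fun d => exists x y, A x /\ A y /\ d = Cmod (x - y)%C)) as [H1 H2].
  split.
  - intros H x y Hx Hy.
    assert (K : Rbar_le (Finite (Cmod (x - y))) (Finite r))
      by (eapply Rbar_le_trans; [apply H1; now exists x, y|exact H]).
    exact K.
  - intros H; apply H2; intros d (x & y & Hx & Hy & ->); now apply H.
Qed.

(** Upper bounds for covering numbers are easier to combine than their exact
    values. *)
Definition coverable (A : C -> Prop) (r x : R) : Prop :=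
  exists n : nat, covered_by A r n /\ INR n <= x.

(** The infimum is over natural numbers, hence attained when it is finite. *)
Lemma covering_number_le (A : C -> Prop) (r x : R) :
  Rbar_le (covering_number A r) (Finite x) <-> coverable A r x.
Proof.
  unfold covering_number; destruct (Glb_Rbar_correct
    (fun x => exists n : nat, covered_by A r n /\ x = INR n)) as [H1 H2].
  split.
  - intros H; destruct (classic (exists n, covered_by A r n)) as [Hex|Hno].
    + destruct (least_nat _ Hex) as [n [Hn Hleast]].
      exists n; split; [exact Hn|].
      assert (K : Rbar_le (Finite (INR n)) (Finite x)); [|exact K].
      eapply Rbar_le_trans; [apply H2|exact H].
      intros y [k [Hk ->]]; simpl; apply le_INR.
      destruct (Nat.lt_ge_cases k n) as [Hlt|]; [|assumption].
      exfalso; exact (Hleast k Hlt Hk).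
    + exfalso. assert (K : Rbar_le p_infty (Finite x)); [|exact K].
      eapply Rbar_le_trans; [apply H2|exact H].
      intros y [k [Hk _]]; exfalso; apply Hno; now exists k.
  - intros [n [Hn Hx]]; eapply Rbar_le_trans; [apply H1; now exists n|exact Hx].
Qed.

Lemma coverable_mono (A B : C -> Prop) (r x y : R) :
  (forall z, A z -> B z) -> x <= y -> coverable B r x -> coverable A r y.
Proof.
  intros HAB Hxy [n [[U [HU Hc]] Hn]]; exists n; split; [|lra].
  exists U; split; auto.
Qed.

Lemma coverable_empty (A : C -> Prop) (r : R) :
  (forall z, ~ A z) -> coverable A r 0.
Proof.
  intros H; exists O; split; [|simpl; lra].
  exists (fun _ _ => False); split; [intros; lia|].
  intros z Hz; destruct (H z Hz).
Qed.

Lemma coverable_union (A B : C -> Prop) (r x y : R) :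
  coverable A r x -> coverable B r y ->
  coverable (fun z => A z \/ B z) r (x + y).
Proof.
  intros [n [[U [HU Uc]] Hn]] [m [[V [HV Vc]] Hm]].
  exists (n + m)%nat; split; [|rewrite plus_INR; lra].
  exists (fun i => if le_lt_dec n i then V (i - n)%nat else U i); split.
  - intros i Hi; destruct (le_lt_dec n i); [apply HV; lia|now apply HU].
  - intros z [Hz|Hz].
    + destruct (Uc z Hz) as [i [Hi Hiz]]; exists i; split; [lia|].
      destruct (le_lt_dec n i); [lia|exact Hiz].
    + destruct (Vc z Hz) as [i [Hi Hiz]]; exists (n + i)%nat; split; [lia|].
      destruct (le_lt_dec n (n + i)); [|lia].
      now replace (n + i - n)%nat with i by lia.
Qed.

Lemma coverable_pieces (n : nat) (V : nat -> C -> Prop) (A : C -> Prop) (r x : R) :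
  (forall i, (i < n)%nat -> coverable (V i) r x) ->
  (forall z, A z -> exists i, (i < n)%nat /\ V i z) ->
  coverable A r (INR n * x).
Proof.
  intros HV HA.
  apply coverable_mono with (fun z => exists i, (i < n)%nat /\ V i z) (INR n * x);
    [exact HA|lra|clear A HA].
  induction n as [|n IH].
  - simpl; rewrite Rmult_0_l; apply coverable_empty; intros z [i [Hi _]]; lia.
  - apply coverable_mono with
      (fun z => (exists i, (i < n)%nat /\ V i z) \/ V n z) (INR n * x + x).
    + intros z [i [Hi Hz]].
      destruct (Nat.eq_dec i n) as [->|]; [now right|left].
      exists i; split; [lia|exact Hz].
    + rewrite S_INR; lra.
    + apply coverable_union; [apply IH; intros; apply HV; lia|apply HV; lia].
Qed.

Lemma coverable_lipschitz (f : C -> C) (A : C -> Prop) (L r x : R) : 0 < L ->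
  (forall z w, A z -> A w -> Cmod (f z - f w) <= L * Cmod (z - w)) ->
  coverable A (r / L) x -> coverable (image_set f A) r x.
Proof.
  intros HL Hf [n [[U [HU Uc]] Hn]]; exists n; split; [|exact Hn].
  (* [f] is controlled on [A] only, and the sets of a cover may leave [A]. *)
  exists (fun i => image_set f (fun z => U i z /\ A z)); split.
  - intros i Hi; apply diam_le; intros p q (z & [Uz Az] & <-) (w & [Uw Aw] & <-).
    assert (K := proj1 (diam_le _ _) (HU i Hi) z w Uz Uw).
    eapply Rle_trans; [now apply Hf|].
    apply Rle_trans with (L * (r / L)); [apply Rmult_le_compat_l; lra|].
    right; field; lra.
  - intros p (z & Az & <-); destruct (Uc z Az) as [i [Hi Uz]].
    exists i; split; [exact Hi|]; now exists z.
Qed.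

(** * Transfer of covering bounds *)

Definition covering_bound (E : C -> Prop) (alpha c : R) : Prop :=
  forall (z : C) (r rho : R), E z -> 0 < r <= rho ->
    coverable (fun w => open_disc z rho w /\ E w) r (c * Rpower (rho / r) alpha).

Lemma pow_le_reg (x y : R) (n : nat) : 0 <= y -> x ^ S n <= y ^ S n -> x <= y.
Proof.
  intros Hy H; apply Rnot_lt_le; intro Hlt.
  assert (K : y ^ S n < x ^ S n); [|lra]; clear H.
  induction n as [|n IH]; [simpl; lra|].
  change (y * y ^ S n < x * x ^ S n).
  apply Rmult_le_0_lt_compat; auto; now apply pow_le.
Qed.

Lemma root_exists (y : R) (n : nat) : 0 < y -> exists x, 0 < x /\ x ^ S n = y.
Proof.
  intros Hy; exists (Rpower y (/ INR (S n))).
  assert (Hx : 0 < Rpower y (/ INR (S n))) by apply exp_pos.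
  split; [exact Hx|].
  rewrite <- Rpower_pow, Rpower_mult, Rinv_l by (exact Hx || (apply not_0_INR; lia)).
  now apply Rpower_1.
Qed.

Section LocalTransfer.

Variables (h : C -> C) (a : C) (n : nat) (E : C -> Prop) (alpha c0 : R).
Hypotheses (Hc0 : 0 < c0) (HE : covering_bound E alpha c0).

Variables (r b K d c : R).
Hypotheses (Hb : 0 < b) (HK : 0 < K) (Hd : 0 < d) (Hc : 0 < c) (HcK : c <= K).
Hypothesis Hsize : forall z, Cmod (z - a) < r ->
  b * Cmod (z - a) ^ S n <= Cmod (h z - h a) <= 4 * b * Cmod (z - a) ^ S n.
Hypothesis Hlip : forall z w s, Cmod (z - a) < r -> Cmod (w - a) < r ->
  Cmod (z - a) <= s -> Cmod (w - a) <= s ->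
  Cmod (h z - h w) <= K * s ^ n * Cmod (z - w).
Hypothesis Hinj : forall z w s, Cmod (z - a) < r -> Cmod (w - a) < r ->
  0 < s -> s <= 8 * r ->
  Cmod (z - a) <= s -> s / 64 <= Cmod (w - a) <= s -> Cmod (z - w) <= d * s ->
  c * s ^ n * Cmod (z - w) <= Cmod (h z - h w).

Variables (z0 : C) (rad s : R).
Hypotheses (Ez0 : E z0) (Hz0 : Cmod (z0 - a) < r) (Hs : 0 < s <= rad).

Let P (z : C) : Prop := E z /\ Cmod (z - a) < r /\ Cmod (h z - h z0) < rad.

(** When the disc in the image is not small compared with the distance of its center
    from [h a], its preimage lies in a disc around [a] of radius [t] with [t ^ S n]
    comparable to [rad]. There [h] is Lipschitz with a constant of order [t ^ n], so
    a single covering of [E] at scale [s / t ^ n] has the right size: the ratio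
    [t / (s / t ^ n)] is of order [rad / s]. *)
Lemma transfer_near_center :
  b / 2 * Cmod (z0 - a) ^ S n <= rad ->
  coverable (image_set h P) s (c0 * Rpower (9 * (3 * K + b) / b) alpha * Rpower (rad / s) alpha).
Proof.
  intros Hcase.
  destruct (root_exists (9 * rad / b) n) as [t [Ht Et]].
  { apply Rdiv_lt_0_compat; lra. }
  assert (Hbt : b * t ^ S n = 9 * rad) by (rewrite Et; field; lra).
  assert (Htn : 0 < t ^ n) by now apply pow_lt.
  assert (Hnear : forall z, Cmod (z - a) < r -> Cmod (h z - h a) <= 9 * rad -> Cmod (z - a) <= t).
  { intros z Hz Hhz; apply (pow_le_reg _ _ n); [lra|].
    apply (Rmult_le_reg_l b); [exact Hb|].
    destruct (Hsize z Hz) as [H1 _]; lra. }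
  assert (Hz0a := Hsize z0 Hz0).
  assert (Hz0t : Cmod (z0 - a) <= t).
  { apply Hnear; [exact Hz0|lra]. }
  assert (HP : forall z, P z -> Cmod (z - a) <= t).
  { intros z (_ & Hz & Hhz); apply Hnear; [exact Hz|].
    assert (T := Cmod_triangle_sub (h z) (h z0) (h a)); lra. }
  rewrite Rmult_assoc, Rpower_mult_distr; [|apply Rdiv_lt_0_compat; lra|apply Rdiv_lt_0_compat; lra].
  apply coverable_lipschitz with (K * t ^ n).
  { now apply Rmult_lt_0_compat. }
  { intros z w Hz Hw; apply Hlip; try apply HP; try assumption; [apply Hz|apply Hw]. }
  (* The summand [b / K] makes the radius at least the covering scale. *)
  set (rho := (3 + b / K) * t).
  assert (HbK : 0 < b / K) by (apply Rdiv_lt_0_compat; lra).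
  assert (Hscale : s / (K * t ^ n) <= rho).
  { apply (Rmult_le_reg_r (K * t ^ n)); [now apply Rmult_lt_0_compat|].
    replace (s / (K * t ^ n) * (K * t ^ n)) with s by (field; lra).
    replace (rho * (K * t ^ n)) with (3 * K * t ^ S n + b * t ^ S n)
      by (unfold rho; simpl; field; lra).
    assert (0 < K * t ^ S n) by (apply Rmult_lt_0_compat; [lra|now apply pow_lt]).
    lra. }
  assert (Hpos : 0 < s / (K * t ^ n)).
  { apply Rdiv_lt_0_compat; [lra|now apply Rmult_lt_0_compat]. }
  apply coverable_mono with (3 := HE z0 _ rho Ez0 (conj Hpos Hscale)).
  - intros z Hz; split; [|apply Hz].
    unfold open_disc, rho.
    assert (T := Cmod_triangle_sub z a z0); rewrite (Cmod_sub_sym a z0) in T.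
    assert (A := HP z Hz).
    assert (0 < b / K * t) by now apply Rmult_lt_0_compat.
    lra.
  - right; f_equal; f_equal.
    replace (rho / (s / (K * t ^ n))) with ((3 * K + b) * t ^ S n / s)
      by (unfold rho; simpl; field; lra).
    rewrite Et; field; lra.
Qed.

(** When the disc in the image stays far from [h a], its preimage lies in an annulus
    around [a], but it may have several components. The covering bound for [E] itself
    cuts the annulus into boundedly many pieces on which [h] is bi-Lipschitz with
    constants of order [t ^ n], and on each piece the ratio of scales is preserved. *)
Lemma transfer_far_from_center :
  rad < b / 2 * Cmod (z0 - a) ^ S n ->
  coverable (image_set h P) s
    (c0 * Rpower (2 / Rmin d 1) alpha * (c0 * Rpower (3 * K / c) alpha)
     * Rpower (rad / s) alpha).
Proof.
  intros Hcase.
  set (d0 := Cmod (z0 - a)) in *.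
  assert (Hd0 : 0 < d0).
  { destruct (Cmod_ge_0 (z0 - a)) as [|E0]; [assumption|].
    unfold d0 in Hcase; rewrite <- E0, pow_ne_zero in Hcase by lia; lra. }
  (* On the preimage [Cmod (z - a) ^ S n] is within a factor 8 of [d0 ^ S n], and
     [8 <= 8 ^ S n], so the distance to [a] is within a factor 8 of [d0]. *)
  set (t := 8 * d0).
  assert (Ht : 0 < t) by (unfold t; lra).
  assert (Htn : 0 < t ^ n) by now apply pow_lt.
  assert (Hd0n : 0 < d0 ^ S n) by now apply pow_lt.
  assert (H8 : 8 <= 8 ^ S n).
  { simpl; generalize (pow_R1_Rle 8 n ltac:(lra)); lra. }
  assert (Hz0a := Hsize z0 Hz0); fold d0 in Hz0a.
  assert (HP : forall z, P z -> t / 64 <= Cmod (z - a) <= t).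
  { intros z (_ & Hz & Hhz).
    destruct (Hsize z Hz) as [S1 S2].
    assert (T1 := Cmod_triangle_sub (h z) (h z0) (h a)).
    assert (T2 := Cmod_triangle_sub (h z0) (h z) (h a)).
    rewrite (Cmod_sub_sym (h z0) (h z)) in T2.
    split.
    - replace (t / 64) with (d0 / 8) by (unfold t; field).
      apply (pow_le_reg _ _ n); [apply Cmod_ge_0|].
      unfold Rdiv; rewrite Rpow_mult_distr, pow_inv.
      apply (Rmult_le_reg_r (8 ^ S n)); [lra|].
      rewrite Rmult_assoc, Rinv_l, Rmult_1_r by lra.
      apply (Rmult_le_reg_l b); [exact Hb|].
      assert (A : b * d0 ^ S n <= 8 * (b * Cmod (z - a) ^ S n)) by lra.
      assert (B : 8 * (b * Cmod (z - a) ^ S n) <= 8 ^ S n * (b * Cmod (z - a) ^ S n)).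
      { apply Rmult_le_compat_r; [|exact H8].
        apply Rmult_le_pos; [lra|apply pow_le, Cmod_ge_0]. }
      lra.
    - unfold t; apply (pow_le_reg _ _ n); [lra|].
      rewrite Rpow_mult_distr.
      apply (Rmult_le_reg_l b); [exact Hb|].
      assert (A : b * Cmod (z - a) ^ S n <= 8 * (b * d0 ^ S n)) by lra.
      assert (B : 8 * (b * d0 ^ S n) <= 8 ^ S n * (b * d0 ^ S n)).
      { apply Rmult_le_compat_r; [|exact H8]; apply Rmult_le_pos; lra. }
      lra. }
  set (e := Rmin d 1).
  assert (He : 0 < e) by (apply Rmin_pos; lra).
  assert (Hed : e <= d) by apply Rmin_l.
  assert (He1 : e <= 1) by apply Rmin_r.
  assert (Het : 0 < e * t) by now apply Rmult_lt_0_compat.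
  assert (Het2 : e * t <= 2 * t) by (apply Rmult_le_compat_r; lra).
  destruct (HE z0 (e * t) (2 * t) Ez0 (conj Het Het2)) as [N [[V [HV Vc]] HN]].
  replace (2 * t / (e * t)) with (2 / e) in HN by (field; lra).
  set (x := c0 * Rpower (3 * K / c) alpha * Rpower (rad / s) alpha).
  assert (Hx : 0 <= x).
  { unfold x; repeat apply Rmult_le_pos; try lra; left; apply exp_pos. }
  apply coverable_mono with (image_set h P) (INR N * x); [auto| |].
  { replace (c0 * Rpower (2 / e) alpha * (c0 * Rpower (3 * K / c) alpha) * Rpower (rad / s) alpha)
      with (c0 * Rpower (2 / e) alpha * x) by (unfold x; ring).
    now apply Rmult_le_compat_r. }
  apply coverable_pieces with (fun i => image_set h (fun z => P z /\ V i z)).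
  2: { intros w (z & Hz & <-).
       destruct (Vc z) as [i [Hi Hiz]].
       - split; [|apply Hz]; unfold open_disc.
         assert (T := Cmod_triangle_sub z a z0); rewrite (Cmod_sub_sym a z0) in T.
         fold d0 in T; specialize (HP z Hz); unfold t in *; lra.
       - exists i; split; [exact Hi|]; now exists z. }
  intros i Hi.
  (* The covering bound is available only around points of [E]. *)
  destruct (classic (exists z, P z /\ V i z)) as [[z1 [Pz1 Vz1]]|Hno].
  2: { apply coverable_mono with (3 := coverable_empty (fun _ => False) s (fun _ F => F));
       [|exact Hx]. intros w (z & Hz & _); apply Hno; now exists z. }
  assert (HV1 : forall z, V i z -> Cmod (z - z1) <= e * t).
  { intros z Hz; now apply (proj1 (diam_le _ _) (HV i Hi)). }
  unfold x; rewrite Rmult_assoc, Rpower_mult_distr;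
    [|apply Rdiv_lt_0_compat; lra|apply Rdiv_lt_0_compat; lra].
  assert (HKt : 0 < K * t ^ n) by now apply Rmult_lt_0_compat.
  assert (Hct : 0 < c * t ^ n) by now apply Rmult_lt_0_compat.
  apply coverable_lipschitz with (K * t ^ n); [exact HKt| |].
  { intros z w [Hz _] [Hw _]; apply Hlip; try (apply HP; assumption); [apply Hz|apply Hw]. }
  set (rho := 3 * rad / (c * t ^ n)).
  assert (Hpos : 0 < s / (K * t ^ n)) by (apply Rdiv_lt_0_compat; lra).
  assert (Hscale : s / (K * t ^ n) <= rho).
  { unfold rho, Rdiv; apply Rmult_le_compat; try lra.
    - left; now apply Rinv_0_lt_compat.
    - apply Rinv_le_contravar; [exact Hct|]; apply Rmult_le_compat_r; lra. }
  apply coverable_mono with (3 := HE z1 _ rho (proj1 Pz1) (conj Hpos Hscale)).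
  - intros z [Hz Vz]; split; [|apply Hz]; unfold open_disc.
    assert (A : c * t ^ n * Cmod (z - z1) <= Cmod (h z - h z1)).
    { apply Hinj; try (apply HP; assumption); try apply Hz; try apply Pz1; try lra.
      - unfold t; lra.
      - eapply Rle_trans; [apply HV1, Vz|]; apply Rmult_le_compat_r; lra. }
    assert (T := Cmod_triangle_sub (h z) (h z0) (h z1)).
    rewrite (Cmod_sub_sym (h z0) (h z1)) in T.
    destruct Hz as (_ & _ & Hz); destruct Pz1 as (_ & _ & Hz1).
    unfold rho; apply (Rmult_lt_reg_l (c * t ^ n)); [exact Hct|].
    replace (c * t ^ n * (3 * rad / (c * t ^ n))) with (3 * rad) by (field; lra).
    lra.
  - right; f_equal; f_equal; unfold rho; field; lra.
Qed.

End LocalTransfer.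

Lemma local_transfer (h : C -> C) (a : C) (n : nat) (E : C -> Prop) (alpha c0 : R) :
  has_order h a n -> 0 < c0 -> covering_bound E alpha c0 ->
  exists r c, 0 < r /\ 0 < c /\
    forall z0 rad s, E z0 -> Cmod (z0 - a) < r -> 0 < s <= rad ->
      coverable
        (image_set h (fun z => E z /\ Cmod (z - a) < r /\ Cmod (h z - h z0) < rad))
        s (c * Rpower (rad / s) alpha).
Proof.
  intros Hord Hc0 HE.
  destruct (has_order_estimates h a n Hord)
    as (r & b & K & d & c & Hr & Hb & HK & Hd & Hc & HcK & Hsize & Hlip & Hinj).
  set (cA := c0 * Rpower (9 * (3 * K + b) / b) alpha).
  set (cB := c0 * Rpower (2 / Rmin d 1) alpha * (c0 * Rpower (3 * K / c) alpha)).
  assert (HA : 0 < cA) by (apply Rmult_lt_0_compat; [lra|apply exp_pos]).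
  assert (HB : 0 < cB).
  { repeat apply Rmult_lt_0_compat; lra || apply exp_pos. }
  exists r, (cA + cB); split; [exact Hr|]; split; [lra|].
  intros z0 rad s Ez0 Hz0 Hs.
  assert (Hp : 0 < Rpower (rad / s) alpha) by apply exp_pos.
  destruct (Rle_or_lt (b / 2 * Cmod (z0 - a) ^ S n) rad) as [Hcase|Hcase].
  - apply coverable_mono with (3 := transfer_near_center h a n E alpha c0 HE r b K
      Hb HK Hsize Hlip z0 rad s Ez0 Hz0 Hs Hcase); [auto|].
    fold cA; apply Rmult_le_compat_r; lra.
  - apply coverable_mono with (3 := transfer_far_from_center h a n E alpha c0 Hc0 HE
      r b K d c Hb HK Hd Hc HcK Hsize Hlip Hinj z0 rad s Ez0 Hz0 Hs Hcase); [auto|].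
    fold cB; apply Rmult_le_compat_r; lra.
Qed.

(** A disc that meets the image of a piece lies in the disc of double radius around a
    point of that image; recentering this way costs the factor [2 ^ alpha]. *)
Lemma finite_transfer (h : C -> C) (E : C -> Prop) (alpha : R)
  (I : Type) (U : I -> C -> Prop) :
  (forall i, exists c, 0 < c /\ forall z0 rad s, E z0 -> U i z0 -> 0 < s <= rad ->
     coverable (image_set h (fun z => E z /\ U i z /\ Cmod (h z - h z0) < rad))
       s (c * Rpower (rad / s) alpha)) ->
  forall l : list I, exists c, 0 < c /\ forall w rad s, 0 < s <= rad ->
    coverable (image_set h (fun z => E z /\ (exists i, In i l /\ U i z)
                                     /\ Cmod (h z - w) < rad))
      s (c * Rpower (rad / s) alpha).
Proof.
  intros HU l; induction l as [|i l [c [Hc IH]]].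
  - exists 1; split; [lra|]; intros w rad s Hs.
    apply coverable_mono with (3 := coverable_empty (fun _ => False) s (fun _ F => F)).
    + intros v (z & (_ & (i & [] & _) & _) & _).
    + rewrite Rmult_1_l; left; apply exp_pos.
  - destruct (HU i) as [ci [Hci Ki]].
    assert (H2 : 0 < Rpower 2 alpha) by apply exp_pos.
    assert (H2c : 0 < ci * Rpower 2 alpha) by now apply Rmult_lt_0_compat.
    exists (ci * Rpower 2 alpha + c); split; [lra|]; intros w rad s Hs.
    rewrite Rmult_plus_distr_r.
    apply coverable_mono with (fun v =>
      image_set h (fun z => E z /\ U i z /\ Cmod (h z - w) < rad) v \/
      image_set h (fun z => E z /\ (exists j, In j l /\ U j z) /\ Cmod (h z - w) < rad) v)
      (ci * Rpower 2 alpha * Rpower (rad / s) alpha + c * Rpower (rad / s) alpha).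
    { intros v (z & (Ez & (j & [<-|Hj] & Uj) & Hz) & <-).
      - left; now exists z.
      - right; exists z; repeat split; auto; now exists j. }
    { lra. }
    apply coverable_union; [|now apply IH].
    destruct (classic (exists z, E z /\ U i z /\ Cmod (h z - w) < rad))
      as [(z1 & E1 & U1 & H1)|Hno].
    + rewrite Rmult_assoc, Rpower_mult_distr by (lra || (apply Rdiv_lt_0_compat; lra)).
      apply coverable_mono with (3 := Ki z1 (2 * rad) s E1 U1 ltac:(lra)).
      * intros v (z & (Ez & Uz & Hz) & <-); exists z; repeat split; auto.
        assert (T := Cmod_triangle_sub (h z) w (h z1)).
        rewrite (Cmod_sub_sym w (h z1)) in T; lra.
      * right; f_equal; f_equal; field; lra.
    + apply coverable_mono with (3 := coverable_empty (fun _ => False) s (fun _ F => F)).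
      * intros v (z & Hz & _); apply Hno; now exists z.
      * apply Rmult_le_pos; [lra|left; apply exp_pos].
Qed.

(** The exponent itself is preserved, with a larger constant: by compactness finitely
    many neighborhoods given by [local_transfer] suffice. *)
Lemma assouad_exponent_image (Omega : C -> Prop) (h : C -> C) (E : C -> Prop) (alpha : R) :
  is_domain Omega -> holomorphic_on Omega h -> ~ constant_on Omega h ->
  compact_set E -> (forall z, E z -> Omega z) ->
  assouad_exponent E alpha -> assouad_exponent (image_set h E) alpha.
Proof.
  intros HOmega Hhol Hnc Hcomp HE [Halpha [c0 [Hc0 Hcov]]].
  assert (HEb : covering_bound E alpha c0).
  { intros z r rho Ez Hr; now apply covering_number_le, Hcov. }
  set (good := fun U : C -> Prop => @open C_UniformSpace U /\
    exists c, 0 < c /\ forall z0 rad s, E z0 -> U z0 -> 0 < s <= rad ->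
      coverable (image_set h (fun z => E z /\ U z /\ Cmod (h z - h z0) < rad))
        s (c * Rpower (rad / s) alpha)).
  (* Indexing the cover by all good neighborhoods avoids choosing one per point. *)
  destruct (Hcomp {U | good U} (fun i => proj1_sig i)) as [l Hl].
  { intros [U [HU HUc]]; exact HU. }
  { intros a Ea.
    destruct (domain_has_order Omega h HOmega Hhol Hnc a (HE a Ea)) as [n Hn].
    destruct (local_transfer h a n E alpha c0 Hn Hc0 HEb) as (r & c & Hr & Hc & K).
    assert (G : good (fun z => Cmod (z - a) < r)).
    { split; [|now exists c].
      apply open_Cmod; intros z Hz; exists (r - Cmod (z - a)); split; [lra|].
      intros w Hw; assert (T := Cmod_triangle_sub w z a); lra. }
    exists (exist _ _ G); simpl.
    replace (a - a)%C with (RtoC 0) by ring; now rewrite Cmod_0. }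
  destruct (finite_transfer h E alpha {U | good U} (fun i => proj1_sig i)) with (l := l)
    as [c [Hc K]].
  { intros [U [HUo HU]]; exact HU. }
  split; [exact Halpha|]; exists c; split; [exact Hc|].
  intros w r rho _ Hr; apply covering_number_le.
  apply coverable_mono with (3 := K w rho r Hr); [|lra].
  intros v [Hv (z & Ez & <-)]; exists z; repeat split; auto.
Qed.

Theorem theorem3p2 (Omega : C -> Prop) (h : C -> C) (E : C -> Prop)
  (HOmega : is_domain Omega)
  (Hhol : holomorphic_on Omega h)
  (Hnc : ~ constant_on Omega h)
  (HEcompact : compact_set E)
  (HE : forall z, E z -> Omega z) :
  Rbar_le (assouad_dim (image_set h E)) (assouad_dim E).
Proof.
  apply Glb_Rbar_correct; intros alpha Halpha.
  apply Glb_Rbar_correct.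
  now apply (assouad_exponent_image Omega h E alpha).
Qed.
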